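(* For every integer $d\geqslant 5$, the set of admissible monomials of weight vector $(2)|(1)|^{d-1}$ in $P_5$ all of whose exponents are positive is exactly $\{a_{d,1},\dots,a_{d,9}\}$, where $a_{d,1}=x_1x_2x_3^{2}x_4^{4}x_5^{2^d-8}$, $a_{d,2}=x_1x_2^{2}x_3x_4^{4}x_5^{2^d-8}$, $a_{d,3}=x_1x_2^{2}x_3^{4}x_4x_5^{2^d-8}$, $a_{d,4}=x_1x_2^{2}x_3^{4}x_4^{2^d-8}x_5$, $a_{d,5}=x_1x_2^{2}x_3^{4}x_4^{8}x_5^{2^d-15}$, $a_{d,6}=x_1x_2^{2}x_3^{4}x_4^{9}x_5^{2^d-16}$, $a_{d,7}=x_1x_2^{2}x_3^{5}x_4^{8}x_5^{2^d-16}$, $a_{d,8}=x_1x_2^{3}x_3^{4}x_4^{8}x_5^{2^d-16}$, $a_{d,9}=x_1^{3}x_2x_3^{4}x_4^{8}x_5^{2^d-16}$. Consequently $\dim QP_5^+((2)|(1)|^{d-1})=9$ and $\dim QP_5((2)|(1)|^{d-1})=124$.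
   Context: $P_k=\mathbb F_2[x_1,\dots,x_k]$, $\deg x_i=1$, with the standard action of the mod-2 Steenrod algebra $\mathcal A$; $\mathcal A^+$ is the augmentation ideal. For a monomial $x$, $\nu_j(x)$ is the exponent of $x_j$, $\alpha_i(a)$ the $i$-th binary digit of $a$, the weight vector is $\omega(x)=(\omega_i(x))_{i\ge1}$ with $\omega_i(x)=\sum_j\alpha_{i-1}(\nu_j(x))$, and the exponent vector is $\sigma(x)=(\nu_1(x),\dots,\nu_k(x))$; both are ordered left-lexicographically, and for monomials of equal degree $u<v$ iff $\omega(u)<\omega(v)$, or $\omega(u)=\omega(v)$ and $\sigma(u)<\sigma(v)$. A monomial $u$ is admissible unless there are monomials $v_1,\dots,v_r<u$ with $u+\sum v_j\in\mathcal A^+P_k$. For a weight vector $\omega$ of degree $\deg\omega=\sum_i2^{i-1}\omega_i$: $P_k(\omega)$ (resp. $P_k^-(\omega)$) is spanned by monomials $y$ with $\deg y=\deg\omega$ and $\omega(y)\le\omega$ (resp. $<\omega$); $QP_k(\omega)=P_k(\omega)/((\mathcal A^+P_k\cap P_k(\omega))+P_k^-(\omega))$; $P_k^+$ is the span of monomials with all exponents positive, and $QP_k^+(\omega)$ is the image of $P_k^+\cap P_k(\omega)$ in $QP_k(\omega)$. Notation: $(2)|(1)|^{d-1}=(2,1,\dots,1,0,\dots)$ with $d-1$ ones. *)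

(* Defs.v *)
From HB Require Import structures.
From mathcomp Require Import all_boot all_order all_algebra.
From mathcomp Require Import mpoly.
Set Implicit Arguments. Unset Strict Implicit. Unset Printing Implicit Defensive.
Import GRing.Theory.
Local Open Scope ring_scope.

(** P_k = F_2[x_1,...,x_k]; variable x_{j+1} is 'X_j, j : 'I_k. *)
Notation Pk k := {mpoly 'F_2[k]}.

(** Action of Sq^i on a monomial, by the Cartan formula:
    Sq^i(x_1^{a_1}...x_k^{a_k}) = sum_{t_1+...+t_k=i} prod_j C(a_j,t_j) x_j^{a_j+t_j}. *)
Definition Sq_mon (k i : nat) (m : 'X_{1..k}) : Pk k :=
  \sum_(t : {ffun 'I_k -> 'I_i.+1} | (\sum_(j < k) (t j : nat))%N == i)
     \prod_(j < k) (('C(m j, t j))%:R * 'X_j ^+ (m j + t j)).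

Definition Sq (k i : nat) (p : Pk k) : Pk k :=
  \sum_(m <- msupp p) p@_m *: Sq_mon i m.

(** A^+ P_k: the F_2-span of the elements Sq^i f with i > 0 (A^+ is spanned by
    products Sq^{i_1}...Sq^{i_r}, r >= 1, i_j > 0, so A^+P_k = sum_{i>0} Sq^i P_k).
    Over F_2 the span consists of the finite sums. *)
Definition hit (k : nat) (p : Pk k) : Prop :=
  exists l : seq (nat * Pk k),
    (forall x, x \in l -> (0 < x.1)%N) /\ p = \sum_(x <- l) Sq x.1 x.2.

(** weight vector: weight m i = omega_{i+1}(m) = sum_j alpha_i(nu_j(m)). *)
Definition weight (k : nat) (m : 'X_{1..k}) (i : nat) : nat :=
  (\sum_(j < k) odd (m j %/ 2 ^ i))%N.

Definition wlt (w1 w2 : nat -> nat) : Prop :=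
  exists i, (forall j, (j < i)%N -> w1 j = w2 j) /\ (w1 i < w2 i)%N.
Definition weq (w1 w2 : nat -> nat) : Prop := forall i, w1 i = w2 i.
Definition wle (w1 w2 : nat -> nat) : Prop := weq w1 w2 \/ wlt w1 w2.

Definition siglt (k : nat) (u v : 'X_{1..k}) : Prop :=
  exists j : 'I_k, (forall l : 'I_k, (l < j)%N -> u l = v l) /\ (u j < v j)%N.

Definition monlt (k : nat) (u v : 'X_{1..k}) : Prop :=
  mdeg u = mdeg v /\
  (wlt (weight u) (weight v) \/ (weq (weight u) (weight v) /\ siglt u v)).

Definition admissible (k : nat) (u : 'X_{1..k}) : Prop :=
  ~ exists vs : seq 'X_{1..k},
      (forall v, v \in vs -> monlt v u) /\
      hit ('X_[u] + \sum_(v <- vs) 'X_[v]).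

Definition wvec (w : seq nat) (i : nat) : nat := nth 0%N w i.
Definition wdeg (w : seq nat) : nat := (\sum_(i < size w) 2 ^ i * nth 0 w i)%N.

Definition Pw (k : nat) (w : seq nat) (p : Pk k) : Prop :=
  forall m, m \in msupp p -> mdeg m = wdeg w /\ wle (weight m) (wvec w).
Definition Pwminus (k : nat) (w : seq nat) (p : Pk k) : Prop :=
  forall m, m \in msupp p -> mdeg m = wdeg w /\ wlt (weight m) (wvec w).
Definition Pplus (k : nat) (p : Pk k) : Prop :=
  forall m, m \in msupp p -> forall j : 'I_k, (0 < m j)%N.

Definition Wsub (k : nat) (w : seq nat) (p : Pk k) : Prop :=
  exists h q, hit h /\ Pw w h /\ Pwminus w q /\ p = h + q.

(** [quot_dim V W n]: the image of the subspace V in the quotient by the subspace W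
    has dimension n over F_2, i.e. there are b_1..b_n in V whose classes mod W
    span the image of V and are linearly independent (over F_2, linear
    combinations are subset sums). *)
Definition quot_dim (k : nat) (V W : Pk k -> Prop) (n : nat) : Prop :=
  exists b : n.-tuple (Pk k),
    (forall i, V (tnth b i)) /\
    (forall p, V p -> exists s : {set 'I_n}, W (p - \sum_(i in s) tnth b i)) /\
    (forall s : {set 'I_n}, W (\sum_(i in s) tnth b i) -> s = set0).

Definition dimQP (k : nat) (w : seq nat) (n : nat) : Prop :=
  quot_dim (@Pw k w) (@Wsub k w) n.
Definition dimQPplus (k : nat) (w : seq nat) (n : nat) : Prop :=
  quot_dim (fun p : Pk k => Pplus p /\ Pw w p) (@Wsub k w) n.

Definition omega_d (d : nat) : seq nat := 2%N :: nseq d.-1 1%N.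

Definition mon5 (a b c e f : nat) : 'X_{1..5} := [multinom [tuple a; b; c; e; f]].

Definition a_list (d : nat) : seq 'X_{1..5} :=
  let N := (2 ^ d)%N in
  [:: mon5 1 1 2 4 (N - 8);
      mon5 1 2 1 4 (N - 8);
      mon5 1 2 4 1 (N - 8);
      mon5 1 2 4 (N - 8) 1;
      mon5 1 2 4 8 (N - 15);
      mon5 1 2 4 9 (N - 16);
      mon5 1 2 5 8 (N - 16);
      mon5 1 3 4 8 (N - 16);
      mon5 3 1 4 8 (N - 16)]%N.

(* Main.v *)
Require Import Defs.
From HB Require Import structures.
From mathcomp Require Import all_boot all_order all_algebra.
From mathcomp Require Import mpoly.
From mathcomp Require Import zify ring.
Set Implicit Arguments. Unset Strict Implicit. Unset Printing Implicit Defensive.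
Import GRing.Theory.
Local Open Scope ring_scope.

(** Modulo the monomials with all exponents even, the weight omega part of P_k
    is spanned by the x_a x_b y^2 with y = x_{s_0} x_{s_1}^2 x_{s_2}^4 ... a
    "word" of length n = d - 1.  The hit relations Sq^1(x_a x_b z^2) and the rule
    "h hit implies x_a h^2 hit" show that the class of x_a x_b y^2 depends only
    on a, b and the support S of y.  Such a class is viewed as an edge of a graph
    whose vertices are the pairs (U, i), U a nonempty set of variables: the
    monomial m is incident to (U, i) when x_i has odd exponent in m and m / x_i
    has support U.  Then Sq^1(x_a x_b x_c z^4) says that triangles of edges sum to
    zero, so that each class is a coboundary f(v) + f(w), the components of the
    graph being indexed by the support T = U + i of the monomials.

    Conversely the functional counting the monomials incident to a given vertex
    kills every Sq^a p with a > 0: on a monomial of degree 2^d - a it gives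
    C(2^d - a - 1, a) times its value, and this binomial is even.  Hence
    QP_k(omega) has dimension the number of vertices minus the number of
    components, (2^k - 1) k - (2^k - 1), and QP_k^+(omega), which is the component
    of full support, has dimension 2k - 1.  The monomials a_{d,l} are the edges of
    the lexicographically minimal spanning tree of that component. *)

(** * Binomial coefficients modulo 2 *)

(** Matches the index type of [Sq_mon] with coefficients of a product of polynomials. It serves
    twice: for the Cartan formula and for the Vandermonde identity in [incidence_Sq]. *)
Lemma coef_prod_ffun (R : comNzRingType) (k i : nat) (P : 'I_k -> {poly R}) :
  (\prod_(j < k) P j)`_i =
  \sum_(t : {ffun 'I_k -> 'I_i.+1} | (\sum_(j < k) (t j : nat))%N == i)
     \prod_(j < k) (P j)`_(t j).
Proof.
(* Truncating each factor at degree i keeps all coefficients up to i and lets the product be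
   distributed over functions into ['I_i.+1]. *)
have eq_low : forall l, (l <= i)%N ->
    (\prod_(j < k) P j)`_l = (\prod_(j < k) take_poly i.+1 (P j))`_l.
  apply: (big_ind2 (fun p q : {poly R} => forall l, (l <= i)%N -> p`_l = q`_l)) => //.
    move=> p p' q q' eqp eqq l le_li; rewrite !coefM; apply: eq_bigr => s _.
    by rewrite eqp ?eqq //; have := ltn_ord s; lia.
  by move=> j _ l le_li; rewrite coef_take_poly ltnS le_li.
rewrite eq_low //.
under [in LHS]eq_bigr => j _ do rewrite /take_poly poly_def.
rewrite bigA_distr_bigA /= coef_sum (bigID (fun t : {ffun 'I_k -> 'I_i.+1} =>
  (\sum_(j < k) (t j : nat))%N == i)) /=.
have coef_mon (t : {ffun 'I_k -> 'I_i.+1}) :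
    (\prod_(j < k) ((P j)`_(t j) *: 'X^(t j)))`_i =
    (\prod_(j < k) (P j)`_(t j)) * (i == \sum_(j < k) (t j : nat))%N%:R.
  rewrite scaler_prod coefZ; congr (_ * _).
  rewrite -(big_morph (fun n => 'X^n) (exprD 'X) (expr0 'X)).
  by rewrite coefXn.
rewrite [X in _ + X]big1 ?addr0 => [|t ne_ti].
  apply: eq_bigr => t /eqP eq_ti; rewrite -[RHS]mulr1 coef_mon.
  by rewrite eq_ti eqxx.
by rewrite coef_mon eq_sym (negPf ne_ti) mulr0.
Qed.

Lemma coef_1XnD (R : comNzRingType) (c : R) (n i : nat) :
  ((1 + c *: 'X) ^+ n)`_i = c ^+ i *+ 'C(n, i).
Proof.
rewrite exprDn coef_sum.
under eq_bigr => j _ do rewrite expr1n mul1r exprZn coefMn coefZ coefXn.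
have [lt_in|le_ni] := ltnP i n.+1.
  rewrite (bigD1 (Ordinal lt_in)) //= eqxx mulr1 big1 ?addr0 // => j ne_ji.
  by rewrite (_ : i == j = false) ?mulr0 ?mul0rn //; apply/negP=> /eqP eij;
     move/eqP: ne_ji; apply; apply: val_inj.
rewrite bin_small // mulr0n big1 // => j _.
by rewrite (_ : i == j = false) ?mulr0 ?mul0rn //; apply/negP=> /eqP eij;
   have := ltn_ord j; rewrite -eij; lia.
Qed.

Lemma natr_F2 (n : nat) : n%:R = (odd n)%:R :> 'F_2.
Proof. by rewrite -[in LHS](odd_double_half n) natrD -muln2 natrM (_ : 2%:R = 0) ?mulr0 ?addr0 //; apply/eqP. Qed.

Lemma F2_cases (a : 'F_2) : a = (a != 0)%:R.
Proof. by case: a => [[|[|//]]] ?; apply/val_inj. Qed.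

(** From i C(n, i) = n C(n - 1, i - 1), whose right side is even. *)
Lemma odd_bin_even_odd (n i : nat) : ~~ odd n -> odd i -> ~~ odd 'C(n, i).
Proof.
case: i => // i en oi; have /(congr1 odd) := mul_bin_diag n i.
by rewrite !oddM oi (negPf en) /= => <-.
Qed.

Lemma odd_bin_odd_even (n i : nat) : odd n -> ~~ odd i -> odd 'C(n, i) = odd 'C(n.-1, i).
Proof.
case: n i => [|n] [|i] //= en; rewrite ?bin0 // negbK => oi.
by rewrite binS oddD (negPf (odd_bin_even_odd en oi)) addbF.
Qed.

Lemma odd_bin_double (n i : nat) : odd 'C(n.*2, i.*2) = odd 'C(n, i).
Proof.
elim: n i => [|n IHn] [|i]; [by []|by rewrite double0 doubleS|by rewrite double0 !bin0|].
rewrite !doubleS !binS !oddD -!doubleS IHn.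
have e2 : ~~ odd 'C(n.*2, i.*2.+1) by apply: odd_bin_even_odd; rewrite /= odd_double.
by rewrite (negPf e2) IHn !addbF.
Qed.

(* All binary digits of a and 2^d - 1 - a are opposite. *)
Lemma bin_compl_even (d a n : nat) : (0 < a)%N -> (n + a).+1 = (2 ^ d)%N -> ~~ odd 'C(n, a).
Proof.
elim: d a n => [|d IHd] a n a_gt0; first by lia.
rewrite expnS mul2n => eq_na.
have odd_na : odd n = ~~ odd a.
  by move/(congr1 odd): eq_na; rewrite /= odd_double oddD; case: (odd n); case: (odd a).
have [oa|ea] := boolP (odd a); first by apply: odd_bin_even_odd => //; rewrite odd_na oa.
rewrite odd_bin_odd_even ?odd_na //.
have -> : (n.-1 = (n./2).*2)%N by rewrite -[in LHS](odd_double_half n) odd_na ea.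
have ea2 : (a = (a./2).*2)%N by rewrite -[LHS](odd_double_half a) (negPf ea).
rewrite ea2 odd_bin_double; apply: IHd.
  by move: a_gt0 ea2; lia.
apply: double_inj; rewrite -eq_na.
move: (odd_double_half n); rewrite odd_na ea; move: ea2.
lia.
Qed.

(** * The total Steenrod square *)

Section SquareCoef.
Variable R : comNzRingType.
Hypothesis R2 : forall x : R, x + x = 0.

(** Frobenius in characteristic two, in the Horner form produced by [poly_ind]; the coefficients of
    a square follow by induction. *)
Lemma poly_sqr_consD (f : {poly R}) (c : R) :
  (f * 'X + c%:P) ^+ 2 = f ^+ 2 * 'X * 'X + (c ^+ 2)%:P.
Proof.
rewrite sqrrD mulr2n.
have -> (g : {poly R}) : g + g = 0.
  by apply/polyP => l; rewrite coefD coef0 R2.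
by rewrite addr0 exprMn polyC_exp -mulrA -expr2.
Qed.

Lemma coef_sqr_even (f : {poly R}) i : (f ^+ 2)`_(i.*2) = f`_i ^+ 2.
Proof.
elim/poly_ind: f i => [|f c IHf] i; first by rewrite expr2 mulr0 !coef0 expr2 mulr0.
rewrite poly_sqr_consD; move: (f ^+ 2) IHf => g IHf.
rewrite coefD coefMX coefMX coefC coefD coefMX coefC.
by case: i => [|i] /=; rewrite ?add0r // !addr0 IHf.
Qed.

Lemma coef_sqr_odd (f : {poly R}) i : (f ^+ 2)`_(i.*2.+1) = 0.
Proof.
elim/poly_ind: f i => [|f c IHf] i; first by rewrite expr2 mulr0 !coef0.
rewrite poly_sqr_consD; move: (f ^+ 2) IHf => g IHf.
rewrite coefD coefMX coefMX coefC /= addr0.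
by case: i => [|i] //=; rewrite IHf.
Qed.

Lemma coef_1XMl (c : R) (g : {poly R}) i :
  ((1 + c *: 'X) * g)`_i.+1 = g`_i.+1 + c * g`_i.
Proof. by rewrite mulrDl mul1r coefD -scalerAl coefZ coefXM. Qed.

End SquareCoef.

Section Steenrod.
Variable k : nat.
Implicit Types (p q : Pk k) (m : 'X_{1..k}).

Lemma Pk_addrr p : p + p = 0.
Proof. by rewrite -mulr2n -scaler_nat (_ : 2%:R = 0) ?scale0r //; apply/eqP. Qed.

Lemma Pk_addKA p q r : p + q + (q + r) = p + r.
Proof. by rewrite addrA -[p + q + q]addrA Pk_addrr addr0. Qed.

Lemma Pk_oppr p : - p = p.
Proof. by apply/esym/eqP; rewrite -addr_eq0 Pk_addrr. Qed.

Lemma Pk_sqrD p q : (p + q) ^+ 2 = p ^+ 2 + q ^+ 2.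
Proof. by rewrite sqrrD mulr2n Pk_addrr addr0. Qed.

(** The total square, a ring morphism with x_j sent to x_j + x_j^2 t. Once its coefficients are
    known to be the Sq^i, the Cartan formula is multiplicativity. *)
Definition total_sq : Pk k -> {poly Pk k} :=
  mmap (polyC \o @mpolyC k 'F_2) (fun j => 'X_j *: (1 + 'X_j *: 'X)).

HB.instance Definition _ := GRing.RMorphism.on total_sq.

Lemma total_sqX (j : 'I_k) : total_sq 'X_j = 'X_j *: (1 + 'X_j *: 'X).
Proof. by rewrite /total_sq mmapX mmap1U. Qed.

Lemma Sq_coef i p : Sq i p = (total_sq p)`_i.
Proof.
rewrite /Sq /total_sq /mmap coef_sum; apply: eq_bigr => m _ /=.
rewrite coefCM mul_mpolyC; congr (_ *: _).
rewrite /mmap1 coef_prod_ffun /Sq_mon; apply: eq_bigr => t _.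
apply: eq_bigr => j _.
rewrite exprZn coefZ coef_1XnD mulrnAr -exprD mulr_natl //.
Qed.

Lemma SqD i p q : Sq i (p + q) = Sq i p + Sq i q.
Proof. by rewrite !Sq_coef rmorphD coefD. Qed.

Lemma hit0 : hit (0 : Pk k).
Proof. by exists [::]; rewrite big_nil. Qed.

Lemma hitD p q : hit p -> hit q -> hit (p + q).
Proof.
move=> [l [l_gt0 ->]] [l' [l'_gt0 ->]]; exists (l ++ l'); rewrite big_cat; split => // x.
by rewrite mem_cat => /orP[/l_gt0|/l'_gt0].
Qed.

Lemma hit_Sq i p : (0 < i)%N -> hit (Sq i p).
Proof.
move=> i_gt0; exists [:: (i, p)]; rewrite big_seq1; split => // x.
by rewrite mem_seq1 => /eqP ->.
Qed.

Lemma hit_ind (P : Pk k -> Prop) :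
  P 0 -> (forall p q, P p -> P q -> P (p + q)) ->
  (forall i p, (0 < i)%N -> P (Sq i p)) -> forall p, hit p -> P p.
Proof.
move=> P0 PD PSq p [l [l_gt0 ->]]; rewrite big_seq.
by apply: (big_ind P) => // x /l_gt0; apply: PSq.
Qed.

(** The total square of x_a p^2 is x_a (1 + x_a t) times a square, which has only even powers of t;
    so the term x_a t does not reach even degrees. *)
Lemma Sq_mulX_sqr (a : 'I_k) p i : Sq i.*2 ('X_a * p ^+ 2) = 'X_a * (Sq i p) ^+ 2.
Proof.
have R2 := Pk_addrr.
rewrite !Sq_coef rmorphM rmorphXn /= total_sqX -scalerAl coefZ -(coef_sqr_even R2).
congr (_ * _); case: i => [|i];
  first by rewrite mulrDl coefD mul1r -scalerAl coefZ coefXM mulr0 addr0.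
by rewrite doubleS coef_1XMl (coef_sqr_odd R2) mulr0 addr0.
Qed.

Lemma hit_mulX_sqr (a : 'I_k) p : hit p -> hit ('X_a * p ^+ 2).
Proof.
elim/hit_ind => [|q r hq hr|i q i_gt0]; first by rewrite expr0n mulr0; apply: hit0.
  by rewrite Pk_sqrD mulrDr; apply: hitD.
by rewrite -Sq_mulX_sqr; apply: hit_Sq; rewrite double_gt0.
Qed.

(** With two factors, (1 + x_a t)(1 + x_b t) has the further even term x_a x_b t^2, whence a
    correction that is a square. *)
Lemma Sq_mulXX_sqr (a b : 'I_k) p i :
  Sq i.+1.*2 ('X_a * 'X_b * p ^+ 2) =
  'X_a * 'X_b * (Sq i.+1 p) ^+ 2 + ('X_a * 'X_b * Sq i p) ^+ 2.
Proof.
have R2 := Pk_addrr.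
rewrite !Sq_coef rmorphM rmorphM rmorphXn /= !total_sqX -!(scalerAl, scalerAr) !coefZ.
rewrite -!mulrA doubleS !coef_1XMl -doubleS.
rewrite !(coef_sqr_even R2) !(coef_sqr_odd R2).
ring.
Qed.

Lemma Sq0 p : Sq 0 p = p.
Proof.
rewrite Sq_coef -horner_coef0 /total_sq /mmap horner_sum [RHS]mpolyE.
apply: eq_bigr => m _ /=; rewrite hornerM hornerC mul_mpolyC; congr (_ *: _).
rewrite horner_prod mpolyXE_id; apply: eq_bigr => j _.
by rewrite horner_exp !hornerE.
Qed.

Lemma Sq1M p q : Sq 1 (p * q) = Sq 1 p * q + p * Sq 1 q.
Proof.
have c0 r : (total_sq r)`_0 = r by rewrite -Sq_coef Sq0.
rewrite !Sq_coef [total_sq (p * q)]rmorphM /=.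
move: (total_sq p) (c0 p) (total_sq q) (c0 q) => f <- g <-.
by rewrite coefM big_ord_recl big_ord1 /= addrC.
Qed.

Lemma Sq1_sqr p : Sq 1 (p ^+ 2) = 0.
Proof. by rewrite expr2 Sq1M mulrC Pk_addrr. Qed.

Lemma Sq1X (a : 'I_k) : Sq 1 'X_a = 'X_a ^+ 2.
Proof. by rewrite Sq_coef total_sqX coefZ coefD coefZ coefX coefC add0r mulr1. Qed.

End Steenrod.

(** * Words *)

Section Words.
Variable k : nat.
Implicit Types (p q : Pk k) (m : 'X_{1..k}) (s t : seq 'I_k).

Fixpoint wordm s : 'X_{1..k} :=
  if s is a :: s' then (U_(a) + wordm s' *+ 2)%MM else 0%MM.

Lemma wordX_cons a s : 'X_[wordm (a :: s)] = 'X_a * 'X_[wordm s] ^+ 2 :> Pk k.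
Proof. by rewrite /= mpolyXD mpolyXn. Qed.

Definition word_eq s t := hit ('X_[wordm s] + 'X_[wordm t] : Pk k).

Lemma word_refl s : word_eq s s.
Proof. by rewrite /word_eq Pk_addrr; apply: hit0. Qed.

Lemma word_sym s t : word_eq s t -> word_eq t s.
Proof. by rewrite /word_eq addrC. Qed.

Lemma word_trans t s u : word_eq s t -> word_eq t u -> word_eq s u.
Proof.
rewrite /word_eq => st tu; have := hitD st tu.
by rewrite Pk_addKA.
Qed.

Lemma word_cons a s t : word_eq s t -> word_eq (a :: s) (a :: t).
Proof. by rewrite /word_eq !wordX_cons -mulrDr -Pk_sqrD; apply: hit_mulX_sqr. Qed.

Lemma hit_Sq1XX a b p : hit (('X_a ^+ 2 * 'X_b + 'X_a * 'X_b ^+ 2) * p ^+ 2).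
Proof.
have -> : ('X_a ^+ 2 * 'X_b + 'X_a * 'X_b ^+ 2) * p ^+ 2 = Sq 1 ('X_a * 'X_b * p ^+ 2).
  by rewrite Sq1M Sq1_sqr mulr0 addr0 Sq1M !Sq1X.
exact: hit_Sq.
Qed.

Lemma word_swap a b s : word_eq (a :: b :: s) (b :: a :: s).
Proof.
rewrite /word_eq !wordX_cons; set z := 'X_[wordm s].
have -> : 'X_a * ('X_b * z ^+ 2) ^+ 2 + 'X_b * ('X_a * z ^+ 2) ^+ 2 =
  ('X_a ^+ 2 * 'X_b + 'X_a * 'X_b ^+ 2) * (z ^+ 2) ^+ 2 by ring.
exact: hit_Sq1XX.
Qed.

(** Trades a surplus copy of a for one of b while both letters stay present, so multiplicities
    change and the support does not. *)
Lemma word_transfer a b s : word_eq (a :: a :: b :: s) (b :: b :: a :: s).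
Proof.
rewrite /word_eq !wordX_cons; set z := 'X_[wordm s].
have -> : 'X_a * ('X_a * ('X_b * z ^+ 2) ^+ 2) ^+ 2 +
          'X_b * ('X_b * ('X_a * z ^+ 2) ^+ 2) ^+ 2 =
  ('X_a ^+ 2 * 'X_b + 'X_a * 'X_b ^+ 2) * ('X_a * 'X_b * z ^+ 4) ^+ 2 by ring.
exact: hit_Sq1XX.
Qed.

Lemma word_bubble a s t : word_eq (s ++ a :: t) (a :: s ++ t).
Proof.
elim: s => [|b s IHs] /=; first exact: word_refl.
exact: word_trans (word_cons b IHs) (word_swap b a _).
Qed.

Lemma word_perm s t : perm_eq s t -> word_eq s t.
Proof.
elim: s t => [|a s IHs] t; first by move/perm_size/eqP; case: t => // _; apply: word_refl.
move=> pst; have : a \in t by rewrite -(perm_mem pst) mem_head.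
move=> a_t; case/splitPr: a_t pst => t1 t2 pst.
apply: word_trans (word_sym (word_bubble a t1 t2)); apply/word_cons/IHs.
by rewrite -(perm_cons a) (perm_trans pst) // -[a :: t2]cat1s perm_catCA.
Qed.

(** Each letter b of [s] is a surplus copy, since [t] keeps one b and one r; [word_transfer] then
    replaces it by r. *)
Lemma word_pad r s t : r \in t -> {subset s <= t} ->
  word_eq (s ++ t) (nseq (size s) r ++ t).
Proof.
move=> r_t; elim: s => [|b s IHs] sub_st; first exact: word_refl.
have b_t : b \in t by apply: sub_st; apply: mem_head.
have /(word_cons b) /= := IHs (fun x xs => sub_st x (mem_behead (xs : x \in behead (b :: s)))).
move/word_trans; apply; have [->|ne_br] := eqVneq b r; first exact: word_refl.
have r_t' : r \in rem b t.
  by move: r_t; rewrite (perm_mem (perm_to_rem b_t)) inE eq_sym (negPf ne_br).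
have pt : perm_eq t [:: b, r & rem r (rem b t)].
  by rewrite (perm_trans (perm_to_rem b_t)) // perm_cons perm_to_rem.
set n := size s; set u := rem r (rem b t).
have perm_front (c : 'I_k) : perm_eq (c :: nseq n r ++ t) [:: c, b, r & nseq n r ++ u].
  rewrite perm_cons; apply: perm_trans (_ : perm_eq _ (nseq n r ++ [:: b, r & u])) _.
    by rewrite perm_cat2l.
  by rewrite -[[:: b, r & u]]/([:: b; r] ++ u) perm_catCA.
apply: word_trans (word_perm (perm_front b)) _.
apply: word_trans (word_transfer b r _) _.
apply/word_perm; rewrite perm_sym (perm_trans (perm_front r)) // perm_cons.
by rewrite -[[:: b, r & _]]/([:: b] ++ [:: r] ++ _) perm_catCA.
Qed.

Lemma perm_undup_rest s : exists2 t, perm_eq s (t ++ undup s) & {subset t <= undup s}.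
Proof.
elim: s => [|a s [t pst sub_t]]; first by exists [::].
rewrite /=; case: ifP => a_s.
  exists (a :: t); first by rewrite /= perm_cons.
  by move=> x; rewrite inE => /predU1P[->|/sub_t //]; rewrite mem_undup.
exists t; first by rewrite perm_sym perm_catC /= perm_cons perm_catC perm_sym.
by move=> x /sub_t xs; rewrite inE xs orbT.
Qed.

(** Both words have the same normal form: surplus copies of one fixed letter, followed by the
    distinct letters once each. *)
Lemma word_eq_mem s t : size s = size t -> s =i t -> word_eq s t.
Proof.
case: s => [|r s']; first by case: t => // _ _; apply: word_refl.
set s := r :: s' => eq_sz eq_st.
have [s1 ps sub_s] := perm_undup_rest s; have [t1 pt sub_t] := perm_undup_rest t.
have r_s : r \in undup s by rewrite mem_undup mem_head.
have r_t : r \in undup t by rewrite mem_undup -eq_st mem_head.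
have pu : perm_eq (undup s) (undup t).
  by apply: uniq_perm; rewrite ?undup_uniq // => x; rewrite !mem_undup.
apply: word_trans (word_perm ps) _; apply: word_trans (word_pad r_s sub_s) _.
apply/word_sym; apply: word_trans (word_perm pt) _.
apply: word_trans (word_pad r_t sub_t) _; apply: word_perm.
have -> : size t1 = size s1.
  move: (perm_size ps) (perm_size pt) (perm_size pu); rewrite !size_cat eq_sz.
  by move=> -> /[swap] -> /addIn.
by rewrite perm_cat2l perm_sym.
Qed.

Lemma wordm_gt0 s i : (0 < wordm s i)%N = (i \in s).
Proof.
elim: s => [|a s IHs] /=; first by rewrite mnm0E.
rewrite mnmDE mulmnE mnm1E inE -IHs eq_sym; case: eqP => //= _.
by rewrite add0n muln_gt0 andbT.
Qed.

Lemma mdeg_wordm s : (mdeg (wordm s)).+1 = (2 ^ size s)%N.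
Proof.
elim: s => [|a s IHs] /=; first by rewrite mdeg0.
rewrite mdegD mdeg1 mdegMn expnS -IHs; lia.
Qed.

End Words.

(** * Edges modulo hit and even polynomials *)

Section Null.
Variable k : nat.
Implicit Types (p q : Pk k) (m : 'X_{1..k}) (s t : seq 'I_k).

Lemma Sq_monE i m : Sq_mon i m =
  \sum_(t : {ffun 'I_k -> 'I_i.+1} | (\sum_(j < k) (t j : nat))%N == i)
     (\prod_(j < k) 'C(m j, t j))%:R *: 'X_[m + [multinom (t j : nat) | j < k]].
Proof.
apply: eq_bigr => t _; rewrite big_split /= natr_prod -mul_mpolyC mpolyXE_id rmorph_prod /=.
congr (_ * _); apply: eq_bigr => j _; last by rewrite mnmDE mnmE.
by rewrite rmorph_nat.
Qed.

(** In degree 2^d with d > 0 these are the monomials of weight below omega, by [evenm_wlt] and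
    [wlt_evenm]. *)
Definition evenm m := [forall j, ~~ odd (m j)].
Definition even_poly p := forall m, m \in msupp p -> evenm m.

Lemma even_poly0 : even_poly 0.
Proof. by move=> m; rewrite msupp0. Qed.

Lemma even_polyD p q : even_poly p -> even_poly q -> even_poly (p + q).
Proof. by move=> ep eq m /msuppD_le; rewrite mem_cat => /orP[/ep|/eq]. Qed.

Lemma even_poly_sqr p : even_poly (p ^+ 2).
Proof.
elim/mpolyind: p => [|c m p _ _ IHp]; first by rewrite expr0n; apply: even_poly0.
rewrite Pk_sqrD; apply: even_polyD => // m' .
rewrite exprZn mpolyXn => /msuppZ_le; rewrite msuppX inE => /eqP ->.
by apply/forallP => j; rewrite mulmnE oddM andbF.
Qed.

(* For homogeneous [p] of weight at most omega this is membership in the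
   subspace factored out in QP_k(omega). *)
Definition null p := exists h q, [/\ hit h, even_poly q & p = h + q].

Lemma null0 : null 0.
Proof. by exists 0, 0; split; [apply: hit0 | apply: even_poly0 | rewrite addr0]. Qed.

Lemma nullD p q : null p -> null q -> null (p + q).
Proof.
move=> [h [e [hh ee ->]]] [h' [e' [hh' ee' ->]]]; exists (h + h'), (e + e').
by split; [apply: hitD | apply: even_polyD | rewrite addrACA].
Qed.

Lemma null_hit p : hit p -> null p.
Proof. by move=> hp; exists p, 0; split; rewrite ?addr0 //; apply: even_poly0. Qed.

Lemma null_even p : even_poly p -> null p.
Proof. by move=> ep; exists 0, p; split; rewrite ?add0r //; apply: hit0. Qed.

Lemma null_sum (I : Type) (r : seq I) (P : pred I) (F : I -> Pk k) :
  (forall i, P i -> null (F i)) -> null (\sum_(i <- r | P i) F i).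
Proof. by move=> nF; apply: big_ind nF; [apply: null0 | apply: nullD]. Qed.

Lemma nullZ (c : 'F_2) p : null p -> null (c *: p).
Proof. by rewrite (F2_cases c); case: (c != 0) => np; rewrite ?scale1r ?scale0r //; apply: null0. Qed.

Definition null_eq p q := null (p + q).

Lemma null_eq_refl p : null_eq p p.
Proof. by rewrite /null_eq Pk_addrr; apply: null0. Qed.

Lemma null_eq_sym p q : null_eq p q -> null_eq q p.
Proof. by rewrite /null_eq addrC. Qed.

Lemma null_eq_trans q p r : null_eq p q -> null_eq q r -> null_eq p r.
Proof. by move=> /nullD npq /npq; rewrite Pk_addKA. Qed.

Lemma null_eqD p p' q q' : null_eq p p' -> null_eq q q' -> null_eq (p + q) (p' + q').
Proof. by move=> /nullD npq /npq; rewrite addrACA. Qed.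

(** The correction term in [Sq_mulXX_sqr] is a square, hence even, so the analogue of [hit_mulX_sqr]
    holds modulo even polynomials. *)
Lemma null_mulXX_sqr (a b : 'I_k) p : hit p -> null ('X_a * 'X_b * p ^+ 2).
Proof.
elim/hit_ind => [|q r hq hr|i q i_gt0]; first by rewrite expr0n mulr0; apply: null0.
  by rewrite Pk_sqrD mulrDr; apply: nullD.
case: i i_gt0 => // i _;
  exists (Sq i.+1.*2 ('X_a * 'X_b * q ^+ 2)), (('X_a * 'X_b * Sq i q) ^+ 2).
split; [exact: hit_Sq | exact: even_poly_sqr|].
by rewrite Sq_mulXX_sqr -addrA Pk_addrr addr0.
Qed.

Definition edgem (a b : 'I_k) s : 'X_{1..k} := (U_(a) + U_(b) + wordm s *+ 2)%MM.

Lemma edgemC a b s : edgem a b s = edgem b a s.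
Proof. by rewrite /edgem [(U_(a) + _)%MM]addmC. Qed.

Lemma edgeXE a b s : 'X_[edgem a b s] = 'X_a * 'X_b * 'X_[wordm s] ^+ 2 :> Pk k.
Proof. by rewrite /edgem 2!mpolyXD mpolyXn. Qed.

Lemma edge_mem a b s t : size s = size t -> s =i t ->
  null_eq 'X_[edgem a b s] 'X_[edgem a b t].
Proof.
move=> est mst; rewrite /null_eq !edgeXE -mulrDr -Pk_sqrD.
exact/null_mulXX_sqr/word_eq_mem.
Qed.

Lemma edge_triangle a b c s : null ('X_[edgem b c (a :: s)] +
  'X_[edgem a c (b :: s)] + 'X_[edgem a b (c :: s)]).
Proof.
apply: null_hit; rewrite !edgeXE !wordX_cons; set z := 'X_[wordm s].
suff -> : 'X_b * 'X_c * ('X_a * z ^+ 2) ^+ 2 + 'X_a * 'X_c * ('X_b * z ^+ 2) ^+ 2 +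
    'X_a * 'X_b * ('X_c * z ^+ 2) ^+ 2 = Sq 1 ('X_a * 'X_b * 'X_c * (z ^+ 2) ^+ 2).
  exact: hit_Sq.
by rewrite Sq1M Sq1_sqr mulr0 addr0 !Sq1M !Sq1X; ring.
Qed.

End Null.

(** * Vertex functionals *)

Section Functional.
Variable k : nat.
Implicit Types (p q : Pk k) (m : 'X_{1..k}) (v : {set 'I_k} * 'I_k).

Definition incident v m :=
  odd (m v.2) && ([set j | (0 < (m - U_(v.2))%MM j)%N] == v.1).

(** Fixing the degree N makes the sum finite; [incidence_Sq] takes N to be a power of two. *)
Definition incidence (N : nat) v p : 'F_2 :=
  \sum_(m : 'X_{1..k < N.+1} | (mdeg m == N) && incident v m) p@_m.

Lemma incidence_is_linear N v : linear (incidence N v : Pk k -> ('F_2)^o).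
Proof.
move=> c p q; rewrite /incidence scaler_sumr -big_split /=.
by apply: eq_bigr => m _; rewrite mcoeffD mcoeffZ.
Qed.

HB.instance Definition _ N v :=
  GRing.isLinear.Build 'F_2 (Pk k) ('F_2)^o _ (incidence N v) (incidence_is_linear N v).

Lemma incidenceX N v m : incidence N v 'X_[m] = ((mdeg m == N) && incident v m)%:R.
Proof.
rewrite /incidence; under eq_bigr => m' _ do rewrite mcoeffX.
have [eq_mN|ne_mN] /= := eqVneq (mdeg m) N; last first.
  rewrite big1 // => m' /andP[/eqP m'N _]; case: eqP => // eq_m.
  by rewrite -m'N -eq_m eqxx in ne_mN.
have lt_mN : (mdeg m < N.+1)%N by rewrite eq_mN.
have [inc_m|ninc_m] := boolP (incident v m).
  rewrite (bigD1 (BMultinom lt_mN)) /= ?eqxx ?eq_mN ?eqxx //= big1 ?addr0 // => m' /andP[_ ne_m'].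
  by case: eqP => // eq_m; case/eqP: ne_m'; apply: val_inj.
rewrite big1 // => m' /andP[_ inc_m']; case: eqP => // eq_m.
by rewrite eq_m inc_m' in ninc_m.
Qed.

(** Moves the incidence test from the terms of Sq^a m to m itself, replacing m by m / x_i in the
    binomials. Both sides vanish if some t_j > m_j, if m_i is even, or if t_i is odd. Otherwise
    C(m_i, t_i) and C(m_i - 1, t_i) have the same parity, and multiplying by the monomial of t
    leaves the support of m / x_i unchanged. *)
Lemma bin_prod_incident v m (t : 'I_k -> nat) :
  ((\prod_j 'C(m j, t j))%:R * (incident v (m + [multinom t j | j < k])%MM)%:R : 'F_2) =
  (\prod_j 'C((m - U_(v.2))%MM j, t j))%:R * (incident v m)%:R.
Proof.
set i := v.2; set m' := (m - U_(i))%MM; set mt := (m + _)%MM.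
have mtE j : mt j = (m j + t j)%N by rewrite mnmDE mnmE.
have m'i : m' i = (m i).-1 by rewrite mnmBE mnm1E eqxx subn1.
have m'j j : j != i -> m' j = m j by move=> ne_ji; rewrite mnmBE mnm1E eq_sym (negPf ne_ji) subn0.
have [/forallP le_tm|/forallPn[j]] := boolP [forall j, t j <= m j]%N; last first.
  rewrite -ltnNge => lt_mt.
  have zero (n : 'I_k -> nat) : (n j <= m j)%N -> (\prod_j 'C(n j, t j))%N = 0%N.
    by move=> le_nm; rewrite (bigD1 j) //= bin_small ?mul0n // (leq_ltn_trans le_nm).
  by rewrite !zero ?mul0r // /m' mnmBE leq_subr.
rewrite (bigD1 i) // [in RHS](bigD1 i) //= m'i.
have -> : (\prod_(j | j != i) 'C(m' j, t j) = \prod_(j | j != i) 'C(m j, t j))%N.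
  by apply: eq_bigr => j ne_ji; rewrite m'j.
set P := (\prod_(j | j != i) _)%N; rewrite !natrM.
have incE : incident v mt = odd (m i + t i) && ([set j | (0 < (mt - U_(i))%MM j)%N] == v.1).
  by rewrite /incident -/i mtE.
rewrite [_%:R in LHS]natr_F2 [_%:R in RHS]natr_F2.
have [odd_m|even_m] := boolP (odd (m i)); last first.
  rewrite {2}/incident (negPf even_m) mulr0 incE oddD (negPf even_m) /=.
  have [odd_t|even_t] := boolP (odd (t i)); last by rewrite mulr0.
  by rewrite (negPf (odd_bin_even_odd even_m odd_t)) !mul0r.
have [odd_t|even_t] := boolP (odd (t i)).
  rewrite incE oddD odd_m odd_t /= mulr0 (negPf (odd_bin_even_odd _ odd_t)) ?mul0r //.
  by move: odd_m; case: (m i).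
rewrite odd_bin_odd_even //; congr (_ * _%:R).
rewrite incE /incident -/i oddD odd_m (negPf even_t) /=; congr (nat_of_bool (_ == _)).
apply/setP => j; rewrite !inE !mnmBE mtE mnm1E; have := le_tm j.
have [<-|_] := eqVneq i j; last by lia.
by move: odd_m even_t; rewrite -!dvdn2 /=; lia.
Qed.

Lemma incidence_Sq d v a p : (0 < a)%N -> incidence (2 ^ d) v (Sq a p) = 0.
Proof.
move=> a_gt0; rewrite /Sq linear_sum big1 // => m _; rewrite linearZ /=.
rewrite (_ : incidence _ _ (Sq_mon a m) = 0) ?scaler0 //.
have mdeg_t (t : {ffun 'I_k -> 'I_a.+1}) : (\sum_j (t j : nat))%N = a ->
    mdeg (m + [multinom (t j : nat) | j < k]) = (mdeg m + a)%N.
  by move=> eq_t; rewrite mdegD [in X in (_ + X)%N]mdegE; under eq_bigr do rewrite mnmE;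
    rewrite eq_t.
rewrite Sq_monE linear_sum /=.
under eq_bigr => t /eqP/mdeg_t eq_t do rewrite linearZ /= incidenceX eq_t.
have [eq_ma|_] /= := eqVneq (mdeg m + a)%N (2 ^ d)%N; last first.
  by rewrite big1 // => t _; rewrite scaler0.
under eq_bigr => t _ do rewrite [_ *: _]bin_prod_incident.
have [inc_m|_] := boolP (incident v m); last by rewrite big1 // => t _; rewrite mulr0.
under eq_bigr => t _ do rewrite mulr1 natr_prod.
set m' := (m - _)%MM.
(* Vandermonde: the sum is the coefficient of X^a in (1 + X)^(deg m - 1), and deg m - 1 = 2^d - a -
   1. *)
have := coef_prod_ffun a (fun j => (1 + (1 : 'F_2) *: 'X) ^+ m' j).
under [in RHS]eq_bigr => t _ do under eq_bigr => j _ do rewrite coef_1XnD expr1n.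
move=> <-; rewrite -(big_morph _ (exprD _) (expr0 _)) coef_1XnD expr1n natr_F2.
rewrite (negPf (bin_compl_even a_gt0 (d := d) _)) // -mdegE -eq_ma -addSn; congr (_ + _)%N.
have /andP[odd_m _] := inc_m.
rewrite -[m in RHS](submK (_ : U_(v.2) <= m)%MM) ?mdegD ?mdeg1 ?addn1 //.
by rewrite lep1mP; case: (m v.2) odd_m.
Qed.

Lemma incidence_hit d v p : hit p -> incidence (2 ^ d) v p = 0.
Proof.
elim/hit_ind => [|q r q0 r0|i q]; [exact: linear0 | by rewrite linearD /= q0 r0 addr0|].
exact: incidence_Sq.
Qed.

Lemma incidence_null d v p : null p -> incidence (2 ^ d) v p = 0.
Proof.
move=> [h [q [hh eq ->]]]; rewrite linearD /= incidence_hit // add0r.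
rewrite /incidence big1 // => m /andP[_ /andP[odd_m _]]; apply: memN_msupp_eq0.
by apply/negP => /eq/forallP/(_ v.2); rewrite odd_m.
Qed.

End Functional.

(** * Weight vectors *)

Section Weights.
Variable k : nat.
Implicit Types (p q : Pk k) (m : 'X_{1..k}) (s t : seq 'I_k).

Definition halfm m : 'X_{1..k} := [multinom (m j)./2 | j < k].

Lemma weightS m i : weight m i.+1 = weight (halfm m) i.
Proof. by apply: eq_bigr => j _; rewrite mnmE expnS divnMA divn2. Qed.

Lemma weight0 m : weight m 0 = #|[set j | odd (m j)]|.
Proof.
rewrite /weight -sum1_card [RHS]big_mkcond; apply: eq_bigr => j _.
by rewrite inE divn1; case: odd.
Qed.

Lemma mdeg_halfm m : mdeg m = (weight m 0 + (mdeg (halfm m)).*2)%N.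
Proof.
rewrite !mdegE -muln2 big_distrl -big_split; apply: eq_bigr => j _ /=.
by rewrite divn1 mnmE muln2 odd_double_half.
Qed.

Lemma eq_halfm m m' : (forall j, odd (m j) = odd (m' j)) -> halfm m = halfm m' -> m = m'.
Proof.
move=> eq_odd eq_half; apply/mnmP => j; rewrite -(odd_double_half (m j)) eq_odd.
have /mnmP/(_ j) := eq_half; rewrite !mnmE => ->.
by rewrite odd_double_half.
Qed.

Lemma odd_wordm_cons a s j : odd (wordm (a :: s) j) = (j == a).
Proof. by rewrite mnmDE mulmnE mnm1E oddD oddM andbF addbF oddb eq_sym. Qed.

Lemma halfm_wordm_cons a s : halfm (wordm (a :: s)) = wordm s.
Proof. by apply/mnmP => j; rewrite mnmE mnmDE mulmnE mnm1E muln2 half_bit_double. Qed.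

Lemma odd_edgem a b s j : a != b -> odd (edgem a b s j) = (j == a) || (j == b).
Proof.
move=> ne_ab; rewrite 2!mnmDE mulmnE !mnm1E !oddD oddM andbF addbF !oddb.
by rewrite ![_ == j]eq_sym; have [->|] := eqVneq j a; rewrite ?(negPf ne_ab).
Qed.

Lemma halfm_edgem a b s : a != b -> halfm (edgem a b s) = wordm s.
Proof.
move=> ne_ab; apply/mnmP => j; rewrite mnmE 2!mnmDE mulmnE !mnm1E muln2.
have [ea|_] := eqVneq a j; have [eb|_] := eqVneq b j; first by rewrite ea eb eqxx in ne_ab.
- by rewrite (half_bit_double _ true).
- by rewrite (half_bit_double _ true).
- by rewrite (half_bit_double _ false).
Qed.

Lemma weight_wordm s i : weight (wordm s) i = (i < size s)%N.
Proof.
elim: s i => [|a s IHs] i.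
  by rewrite /weight big1 // => j _; rewrite mnm0E div0n.
case: i => [|i]; last by rewrite weightS halfm_wordm_cons IHs.
rewrite weight0 (_ : [set j | _] = [set a]) ?cards1 //.
by apply/setP => j; rewrite !inE odd_wordm_cons.
Qed.

Lemma weight_eq0 m : (forall i, weight m i = 0%N) -> m = 0%MM.
Proof.
have [n] := ubnP (mdeg m); elim: n m => // n IHn m lt_mn w0.
apply/eqP; rewrite -mdeg_eq0; apply/negPn/negP => m_n0.
have half0 : halfm m = 0%MM.
  apply: IHn => [|i]; last by rewrite -weightS.
  by move: lt_mn m_n0; rewrite (mdeg_halfm m) w0; lia.
by rewrite (mdeg_halfm m) w0 half0 mdeg0 in m_n0.
Qed.

Lemma wordm_of_weight n m : (forall i, weight m i = (i < n)%N) ->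
  exists2 s, size s = n & m = wordm s.
Proof.
elim: n m => [|n IHn] m wm; first by exists [::] => //; apply: weight_eq0.
have [|s sz_s half_s] := IHn (halfm m); first by move=> i; rewrite -weightS wm.
have /eqP/cards1P[a oddE] : #|[set j | odd (m j)]| = 1%N by rewrite -weight0 wm.
exists (a :: s); rewrite /= ?sz_s //; apply: eq_halfm; last by rewrite halfm_wordm_cons.
by move=> j; rewrite odd_wordm_cons; have /setP/(_ j) := oddE; rewrite !inE.
Qed.

Lemma wvec_omega0 d : wvec (omega_d d) 0 = 2%N. Proof. by []. Qed.

Lemma wvec_omegaS d i : wvec (omega_d d.+1) i.+1 = (i < d)%N.
Proof. by rewrite /wvec /= nth_nseq; case: ltnP. Qed.

Lemma wdeg_omega d : wdeg (omega_d d.+1) = (2 ^ d.+1)%N.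
Proof.
rewrite /wdeg /= size_nseq big_ord_recl expn0 mul1n.
have -> : (\sum_(i < d) 2 ^ bump 0 i * nth 0 (2 :: nseq d 1) (bump 0 i) = \sum_(i < d) 2 * 2 ^ i)%N.
  by apply: eq_bigr => i _; rewrite /bump /= add1n nth_nseq ltn_ord muln1 expnS.
rewrite -big_distrr /= expnS -mulnS; congr (2 * _)%N.
elim: d => [|d IHd]; first by rewrite big_ord0.
by rewrite big_ord_recr /= -addSn IHd expnS mul2n addnn.
Qed.

Lemma edgem_weight a b s d : a != b -> size s = d ->
  weq (weight (edgem a b s)) (wvec (omega_d d.+1)).
Proof.
move=> ne_ab sz_s [|i]; last by rewrite weightS halfm_edgem // weight_wordm wvec_omegaS sz_s.
rewrite weight0 wvec_omega0 (_ : [set j | _] = [set a; b]) ?cards2 ?ne_ab //.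
by apply/setP => j; rewrite !inE odd_edgem.
Qed.

Lemma edgem_of_weight d m : weq (weight m) (wvec (omega_d d.+1)) ->
  exists a b s, [/\ a != b, size s = d & m = edgem a b s].
Proof.
move=> wm; have [|s sz_s half_s] := @wordm_of_weight d (halfm m).
  by move=> i; rewrite -weightS wm wvec_omegaS.
have /eqP/cards2P[a [b [ne_ab oddE]]] : #|[set j | odd (m j)]| = 2%N by rewrite -weight0 wm.
exists a, b, s; split=> //; apply: eq_halfm; last by rewrite halfm_edgem.
by move=> j; rewrite odd_edgem //; have /setP/(_ j) := oddE; rewrite !inE.
Qed.

Lemma mdeg_edgem a b s : mdeg (edgem a b s) = (2 ^ (size s).+1)%N.
Proof. by rewrite /edgem 2!mdegD !mdeg1 mdegMn expnS -mdeg_wordm; lia. Qed.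

Lemma evenm_wlt d m : evenm m -> wlt (weight m) (wvec (omega_d d)).
Proof.
move=> /forallP ev_m; exists 0%N; split=> //; rewrite weight0 (_ : [set j | _] = set0) ?cards0 //.
by apply/setP => j; rewrite !inE (negPf (ev_m j)).
Qed.

(** An odd degree forces an odd exponent. When exactly one exponent is odd, halving the exponents
    turns degree 2^n - 1 into 2^(n-1) - 1, and the argument repeats. *)
Lemma weight_ones_neq0 n m i : (mdeg m).+1 = (2 ^ n)%N -> (i < n)%N ->
  (forall j, (j < i)%N -> weight m j = 1%N) -> weight m i != 0%N.
Proof.
elim: n m i => [|n IHn] m [|i] //.
  by move=> + _ _; rewrite (mdeg_halfm m) expnS; case: (weight m 0); lia.
rewrite ltnS => deg_m lt_in w1; rewrite weightS; apply: IHn => // [|j lt_ji];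
  last by rewrite -weightS w1.
by move: deg_m; rewrite (mdeg_halfm m) w1 // expnS; lia.
Qed.

(** The first weight has the parity of the degree, so below 2 it is 0. A first drop at a later place
    would be a 0 instead of a 1, which [weight_ones_neq0] excludes. *)
Lemma wlt_evenm d m : mdeg m = (2 ^ d.+1)%N ->
  wlt (weight m) (wvec (omega_d d.+1)) -> evenm m.
Proof.
move=> deg_m [[|i] [eq_w]].
  move: deg_m; rewrite wvec_omega0 (mdeg_halfm m) expnS => deg_m lt_w.
  have /eqP : weight m 0 = 0%N by lia.
  rewrite weight0 cards_eq0 => /eqP/setP odd0; apply/forallP => j.
  by have := odd0 j; rewrite !inE => ->.
rewrite wvec_omegaS => lt_w; have lt_id : (i < d)%N by case: (i < d)%N lt_w.
have w0 : weight (halfm m) i == 0%N by rewrite -weightS; move: lt_w; rewrite lt_id; case: weight.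
have w02 := eq_w 0%N isT; rewrite wvec_omega0 in w02.
suff : weight (halfm m) i != 0%N by rewrite w0.
apply: (@weight_ones_neq0 d) => //.
  by move: deg_m; rewrite (mdeg_halfm m) w02 expnS; lia.
by move=> j lt_ji; rewrite -weightS eq_w // wvec_omegaS (ltn_trans lt_ji).
Qed.

Lemma Pw_omegaP d p : Pw (omega_d d.+1) p <-> forall m, m \in msupp p ->
  mdeg m = (2 ^ d.+1)%N /\ (evenm m \/ weq (weight m) (wvec (omega_d d.+1))).
Proof.
split=> Pp m /Pp; rewrite wdeg_omega => -[deg_m wm]; split=> //.
  by case: wm => [|/wlt_evenm]; [right | left; auto].
by case: wm => [/evenm_wlt|]; [right | left].
Qed.

(** The Sq^i are homogeneous. This is needed because [Wsub] requires the hit part itself to lie in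
    P_k(omega), whereas [null] allows any degrees. *)
Lemma pihomog_hit n p : hit p -> hit (pihomog mdeg n p).
Proof.
elim/hit_ind => [|q r hq hr|i q i_gt0]; first by rewrite pihomog0; apply: hit0.
  by rewrite pihomogD; apply: hitD.
elim/mpolyind: q => [|c m q _ _ IHq].
  by rewrite /Sq msupp0 big_nil pihomog0; apply: hit0.
rewrite SqD pihomogD; apply: (hitD _ IHq).
have dh_Sq : Sq i (c *: 'X_[m]) \is (mdeg m + i)%N.-homog.
  apply: rpred_sum => m' _; have [->|eq_mm'] := eqVneq m m'; last first.
    by rewrite mcoeffZ mcoeffX (negPf eq_mm') mulr0 scale0r rpred0.
  rewrite Sq_monE dhomogZ //; apply: rpred_sum => t /eqP eq_t; rewrite dhomogZ // dhomogX /=.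
  by rewrite mdegD [in X in (_ + X)%N]mdegE; under eq_bigr do rewrite mnmE; rewrite eq_t.
have [eq_n|ne_n] := eqVneq (mdeg m + i)%N n.
  by rewrite -eq_n pihomog_dE //; apply: hit_Sq.
by rewrite (pihomog_ne0 ne_n dh_Sq); apply: hit0.
Qed.

Lemma Wsub_null d p : Pw (omega_d d.+1) p -> null p -> Wsub (omega_d d.+1) p.
Proof.
move=> Pp [h [q [hh eq_q def_p]]]; have PpE := (Pw_omegaP d p).1 Pp.
set N := (2 ^ d.+1)%N in PpE; set h' := pihomog mdeg N h; set q' := pihomog mdeg N q.
have def_p' : p = h' + q'.
  rewrite -pihomogD -def_p pihomog_dE //; apply/dhomogP => m mp; exact: (PpE m mp).1.
have q'P m : m \in msupp q' -> mdeg m = N /\ evenm m.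
  move=> mq; split; first by have /dhomogP := pihomogP mdeg N q; apply.
  apply: eq_q; move: mq; rewrite /q' pihomogE => /msupp_sum_le /flattenP[ms].
  by case/mapP=> m'; rewrite mem_filter => /andP[_ m'q] -> /msuppZ_le;
    rewrite msuppX inE => /eqP ->.
(* In characteristic two the hit part is the sum of two elements of P_k(omega), so it lies there
   too. *)
have def_h' : h' = p + q' by rewrite def_p' -addrA Pk_addrr addr0.
exists h', q'; split; first exact: pihomog_hit.
split.
  apply/Pw_omegaP => m; rewrite def_h' => /msuppD_le;
    rewrite mem_cat => /orP[/PpE //|/q'P[-> ev_m]].
  by split=> //; left.
by split=> // m /q'P[deg_m ev_m]; rewrite wdeg_omega; split=> //; apply: evenm_wlt.
Qed.

Lemma null_Wsub d p : Wsub (omega_d d.+1) p -> null p.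
Proof.
move=> [h [q [hh [_ [qP ->]]]]]; exists h, q; split=> // m /qP[].
by rewrite wdeg_omega; apply: wlt_evenm.
Qed.

End Weights.

(** * Edges as coboundaries *)

(** A canonical word with letters S; by [edge_mem] the choice of the repeated letter does not affect
    classes. *)
Definition padword k (n : nat) (S : {set 'I_k}) : seq 'I_k :=
  if enum S is a :: _ then nseq (n - #|S|) a ++ enum S else [::].

Lemma padword_mem k n (S : {set 'I_k}) : padword n S =i S.
Proof.
move=> i; rewrite /padword -[RHS]mem_enum; case ES: (enum S) => [|a s] //.
by rewrite -ES mem_cat mem_nseq; case: eqP => [->|_]; rewrite ?andbF // ES mem_head orbT.
Qed.

Lemma size_padword k n (S : {set 'I_k}) : (0 < #|S| <= n)%N -> size (padword n S) = n.
Proof.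
rewrite /padword cardE; case ES: (enum S) => [|a s] //= leSn.
by rewrite -ES size_cat size_nseq ES subnK.
Qed.

Section Potential.
Variables k n : nat.
Hypotheses (le4n : (4 <= n)%N) (le_kn : (k <= n)%N).
Local Notation letter := 'I_k.+1.
Implicit Types (T S : {set letter}) (x y z : letter * bool) (v : {set letter} * letter).
Implicit Types (m : 'X_{1..k.+1}) (p : Pk k.+1).

(* A pair [(i, e)] is a variable of a monomial together with the truth value of
   "its exponent exceeds 1".  [erased] is what it removes from the support T
   of a monomial x_a x_b y^2 to leave the support of y. *)
Definition erased x : {set letter} := if x.2 then set0 else [set x.1].

Definition core T x y : {set letter} := T :\: erased x :\: erased y.

Definition edge T x y : 'X_{1..k.+1} := edgem x.1 y.1 (padword n (core T x y)).

Definition avail T x y := (0 < #|core T x y| <= n)%N.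

(** The support of m / x_i is T if the exponent of x_i exceeds 1 and T without i otherwise, so this
    is the pair (U, i) tested by [incident]. *)
Definition vertex T x : {set letter} * letter := (T :\: erased x, x.1).

Lemma coreC T x y : core T x y = core T y x.
Proof. by rewrite /core setDDl setUC -setDDl. Qed.

Lemma edgeC T x y : edge T x y = edge T y x.
Proof. by rewrite /edge coreC edgemC. Qed.

Lemma availC T x y : avail T x y = avail T y x.
Proof. by rewrite /avail coreC. Qed.

Lemma in_erased x i : (i \in erased x) = ~~ x.2 && (i == x.1).
Proof. by rewrite /erased; case: x.2; rewrite inE. Qed.

Lemma core_restore T x y : x.1 \in T -> y.1 \in T -> x.1 != y.1 ->
  y.1 |: core T x y = T :\: erased x.
Proof.
move=> xT yT ne_xy; apply/setP => i; rewrite !(inE, in_erased).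
by have [->|_] := eqVneq i y.1; rewrite ?(eq_sym y.1) ?(negPf ne_xy) ?andbF ?andbT ?yT.
Qed.

(** Reduces an arbitrary monomial of weight omega to a canonical edge, so that only supports and
    flags matter afterwards. *)
Lemma edge_of_word a b (s : seq letter) :
  a != b -> size s = n -> let T := a |: (b |: [set i in s]) in
  [/\ core T (a, a \in s) (b, b \in s) = [set i in s],
      avail T (a, a \in s) (b, b \in s) &
      null_eq 'X_[edgem a b s] 'X_[edge T (a, a \in s) (b, b \in s)]].
Proof.
move=> ne_ab sz_s T.
have coreE : core T (a, a \in s) (b, b \in s) = [set i in s].
  apply/setP => i; rewrite /T !(inE, in_erased) /=.
  case: (eqVneq i b) => [->|_]; first by rewrite [b == a]eq_sym (negPf ne_ab) andbF;
    case: (b \in s).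
  by case: (eqVneq i a) => [->|_]; rewrite ?andbF //; case: (a \in s).
have card_s : (0 < #|[set i in s]| <= n)%N.
  rewrite cardsE (leq_trans (card_size s)) ?sz_s // andbT; apply/card_gt0P.
  by case: s sz_s {T coreE} => [|c s _]; [move: le4n; case: n | exists c; apply: mem_head].
split; rewrite /avail /edge coreE //.
apply: edge_mem; first by rewrite size_padword.
by move=> i; rewrite padword_mem inE.
Qed.

(** [edge_triangle] needs a common word of length n - 1. Its letters are T with all three erased
    parts removed; prefixing the variable opposite to an edge gives back the core of that edge. *)
Lemma null_eq_triangle T x y z :
  x.1 \in T -> y.1 \in T -> z.1 \in T -> x.1 != y.1 -> x.1 != z.1 -> y.1 != z.1 ->
  (0 < #|core T x y :\: erased z| < n)%N ->
  null_eq 'X_[edge T y z] ('X_[edge T x y] + 'X_[edge T x z]).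
Proof.
move=> xT yT zT ne_xy ne_xz ne_yz; set S := core T x y :\: _ => card_S.
have sz_S : size (padword n.-1 S) = n.-1 by apply: size_padword; move: card_S; lia.
have edge_S u w i : core T u w =i i |: S -> (0 < #|i |: S| <= n)%N ->
    null_eq 'X_[edge T u w] 'X_[edgem u.1 w.1 (i :: padword n.-1 S)].
  move=> core_uw card_iS; apply: edge_mem => [|j]; last first.
    by rewrite padword_mem core_uw in_setU1 in_cons padword_mem.
  rewrite size_padword ?(eq_card core_uw) //= sz_S prednK //.
  exact: leq_trans le4n.
have card_add i : (0 < #|i |: S| <= n)%N by rewrite cardsU1; case: (i \notin S) card_S; lia.
have [ne_yx ne_zx ne_zy] : [/\ y.1 != x.1, z.1 != x.1 & z.1 != y.1] by rewrite ![_ == x.1]eq_sym [z.1 == _]eq_sym.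
have eq_yz : null_eq 'X_[edge T y z] 'X_[edgem y.1 z.1 (x.1 :: padword n.-1 S)].
  apply: edge_S => // i; rewrite /S /core !(inE, in_erased).
  by have [->|_] := eqVneq i x.1; rewrite ?(negPf ne_xy) ?(negPf ne_xz) ?xT ?andbF ?andbT.
have eq_xz : null_eq 'X_[edge T x z] 'X_[edgem x.1 z.1 (y.1 :: padword n.-1 S)].
  apply: edge_S => // i; rewrite /S /core !(inE, in_erased).
  by have [->|_] := eqVneq i y.1; rewrite ?(negPf ne_yx) ?(negPf ne_yz) ?yT ?andbF ?andbT.
have eq_xy : null_eq 'X_[edge T x y] 'X_[edgem x.1 y.1 (z.1 :: padword n.-1 S)].
  apply: edge_S => // i; rewrite /S /core !(inE, in_erased).
  by have [->|_] := eqVneq i z.1; rewrite ?(negPf ne_zx) ?(negPf ne_zy) ?zT ?andbF ?andbT.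
apply: null_eq_trans eq_yz _; apply/null_eq_sym; apply: null_eq_trans (null_eqD eq_xy eq_xz) _.
by rewrite /null_eq addrC [X in _ + X]addrC addrA; apply: edge_triangle.
Qed.

(* Words have length n, so an edge needs a nonempty core of size at most n, and a
   triangle one of size at most n - 1.  With [star T] as its second component, a
   variable can be joined to every other one, and completes every edge to a
   triangle. *)
Definition star T := (#|T| < n)%N.

(** If |T| < n then x erases nothing and its variable remains in the core. Otherwise x erases its
    variable, which brings the size down to at most n. *)
Lemma star_avail T x y : (#|T| <= n.+1)%N ->
  x.1 \in T -> y.1 \in T -> x.1 != y.1 -> x.2 = star T -> avail T x y.
Proof.
move=> le_Tn xT yT ne_xy x_star.
have card_y : (#|T :\: erased y| <= #|T| <= #|T :\: erased y|.+1)%N.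
  rewrite subset_leq_card ?subsetDl //= /erased; case: y.2; first by rewrite setD0 leqnSn.
  by rewrite (cardsD1 y.1 T) yT add1n.
have xTy : x.1 \in T :\: erased y by rewrite !(inE, in_erased) (negPf ne_xy) andbF.
have er_x : erased x = if (#|T| < n)%N then set0 else [set x.1] by rewrite /erased x_star.
rewrite /avail coreC /core er_x; case: (ltnP #|T| n) => [lt_Tn|le_nT] /=.
  rewrite setD0 card_gt0; apply/andP; split; first by apply/set0Pn; exists x.1.
  by have /andP[le_y _] := card_y; apply: leq_trans le_y (ltnW lt_Tn).
move: card_y; rewrite (cardsD1 x.1 (T :\: _)) xTy add1n.
move: le_Tn le_nT; move: #|T| #|T :\: erased y :\ x.1| => a c; lia.
Qed.

Lemma star_triangle T x y z : (#|T| <= n.+1)%N ->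
  x.1 \in T -> y.1 \in T -> z.1 \in T -> x.1 != y.1 -> x.1 != z.1 -> y.1 != z.1 ->
  x.2 = star T -> avail T y z ->
  null_eq 'X_[edge T y z] ('X_[edge T x y] + 'X_[edge T x z]).
Proof.
move=> le_Tn xT yT zT ne_xy ne_xz ne_yz x_star av_yz; apply: null_eq_triangle => //.
have -> : core T x y :\: erased z = core T y z :\: erased x.
  by rewrite /core !setDDl; congr (_ :\: _); rewrite setUC -setUA.
have card_yz : (#|T| <= #|core T y z|.+2)%N.
  have card_del S u : (#|S| <= #|S :\: erased u|.+1)%N.
    by rewrite /erased; case: u.2; rewrite ?setD0 // (cardsD1 u.1 S); case: (_ \in _).
  by rewrite (leq_trans (card_del T y)) // ltnS card_del.
have le_yzT : (#|core T y z| <= #|T|)%N.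
  by apply/subset_leq_card/(subset_trans (subsetDl _ _))/subsetDl.
have x_yz : x.1 \in core T y z by rewrite !(inE, in_erased) (negPf ne_xy) (negPf ne_xz) !andbF.
have er_x : erased x = if (#|T| < n)%N then set0 else [set x.1] by rewrite /erased x_star.
rewrite er_x; case: (ltnP #|T| n) => [lt_Tn|le_nT] /=.
  rewrite setD0 card_gt0; apply/andP; split; first by apply/set0Pn; exists x.1.
  exact: leq_ltn_trans le_yzT lt_Tn.
(* Here n >= 4 enters: T has at least four elements and loses at most three, so the common word has
   a letter. *)
move: av_yz card_yz le_nT; rewrite /avail (cardsD1 x.1 (core T y z)) x_yz add1n.
by move: #|T| #|core T y z :\ x.1| => a c; lia.
Qed.

(** The default [ord0] is returned only when there is nothing to pick; [letter1_in] and [letter2_in]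
    cover the other cases. *)
Definition letter1 T : letter := odflt ord0 [pick r in T].
Definition letter2 T : letter := odflt ord0 [pick s in T :\ letter1 T].

Lemma letter1_in T i : i \in T -> letter1 T \in T.
Proof. by rewrite /letter1; case: pickP => //= no /(conj (no i)) []; rewrite -topredE /= => ->. Qed.

Lemma letter2_in T i : i \in T -> i != letter1 T -> letter2 T \in T /\ letter2 T != letter1 T.
Proof.
move=> iT ne_i; rewrite /letter2; case: pickP => [s|no] /=.
  by rewrite !inE => /andP[].
by have := no i; rewrite !inE ne_i iT.
Qed.

Definition hub T : letter * bool := (letter1 T, star T).

(* The sum of the edges on a path from [x] to [hub T]. *)
Definition hub_path T x : Pk k.+1 :=
  if x.1 == letter1 T then
    if x.2 == star T then 0
    else 'X_[edge T (letter2 T, star T) x] + 'X_[edge T (hub T) (letter2 T, star T)]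
  else 'X_[edge T (hub T) x].

(** Away from the variable of the hub this is a triangle with the hub. The hub and its twin, the
    same variable with the opposite flag, are never joined by an edge; the twin is reached through
    [letter2 T]. *)
Lemma edge_path T x y : x.1 \in T -> y.1 \in T -> x.1 != y.1 -> avail T x y ->
  null_eq 'X_[edge T x y] (hub_path T x + hub_path T y).
Proof.
have le_Tn : (#|T| <= n.+1)%N by rewrite (leq_trans (max_card _)) // card_ord.
(* The two variables differ, so at most one is that of the hub; by symmetry it is not that of y. *)
wlog ne_y : x y / y.1 != letter1 T.
  move=> IH xT yT ne_xy av_xy; have [ey|ne_y] := eqVneq y.1 (letter1 T); last exact: IH.
  rewrite edgeC addrC; apply: IH => //; last by rewrite availC.
    by rewrite -ey.
  by rewrite eq_sym.
move=> xT yT ne_xy av_xy; have rT := letter1_in yT; have [sT ne_s] := letter2_in yT ne_y.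
have hub_pathE z : z.1 != letter1 T -> hub_path T z = 'X_[edge T (hub T) z].
  by rewrite /hub_path => /negPf ->.
rewrite (hub_pathE y) //.
have [ex|ne_x] := eqVneq x.1 (letter1 T); last first.
  rewrite hub_pathE //; apply: star_triangle; rewrite //= 1?eq_sym //.
rewrite /hub_path ex eqxx; have [ex2|ne_x2] := eqVneq x.2 (star T).
  by rewrite add0r /hub -ex -ex2; case: x {xT ne_xy av_xy ex ex2} => ? ?; apply: null_eq_refl.
(* From here x is the twin of the hub. Two triangles with apex [(letter2 T, star T)], one through x
   and one through the hub, treat every z with a third variable. *)
have edge_rest z : z.1 \in T -> z.1 != letter1 T -> z.1 != letter2 T -> avail T x z ->
    null_eq 'X_[edge T x z] ('X_[edge T (letter2 T, star T) x] +
      'X_[edge T (hub T) (letter2 T, star T)] + 'X_[edge T (hub T) z]).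
  move=> zT ne_z1 ne_z2 av_xz.
  have tri : null_eq 'X_[edge T x z] ('X_[edge T (letter2 T, star T) x] + 'X_[edge T (letter2 T, star T) z]).
    by apply: star_triangle; rewrite //= ?ex // eq_sym.
  apply: null_eq_trans tri _; rewrite -addrA; apply: null_eqD; first exact: null_eq_refl.
  apply: star_triangle; rewrite //= 1?eq_sym //.
  by apply: star_avail => //=; rewrite eq_sym.
have [ey|ne_y2] := eqVneq y.1 (letter2 T); last exact: edge_rest.
have [ey2|ney2] := eqVneq y.2 (star T).
  have -> : (letter2 T, star T) = y by rewrite -ey -ey2; case: (y).
  by rewrite -addrA Pk_addrr addr0 edgeC; apply: null_eq_refl.
(* Now y is the twin of the apex, and a third variable c is needed. For |T| < n both flags are
   false, so the nonempty core of the edge supplies c; otherwise |T| >= 4. *)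
have /card_gt0P[c] : (0 < #|T :\ letter1 T :\ letter2 T|)%N.
  have [lt_Tn|le_nT] := ltnP #|T| n.
    move: ne_x2 ney2 av_xy; rewrite /avail /core /erased ex ey /star lt_Tn.
    by case: x.2; case: y.2 => //= _ _ /andP[].
  move: le_nT; rewrite (cardsD1 (letter1 T) T) rT (cardsD1 (letter2 T) (T :\ _)) !inE sT ne_s /=.
  by move: #|_ :\ letter2 T| => c; lia.
rewrite !inE => /and3P[ne_c2 ne_c1 cT].
have [ne_1c ne_2c ne_1s] : [/\ letter1 T != c, letter2 T != c & letter1 T != letter2 T].
  by rewrite ![letter1 T == _]eq_sym [letter2 T == c]eq_sym.
pose z := (c, star T).
have tri_xy : null_eq 'X_[edge T x y] ('X_[edge T z x] + 'X_[edge T z y]).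
  by apply: star_triangle => //=; rewrite ?ex ?ey.
apply: null_eq_trans tri_xy _.
have rest_z := edge_rest z cT ne_c1 ne_c2; rewrite edgeC in rest_z.
have av_xz : avail T x z by rewrite availC; apply: star_avail => //=; rewrite ex.
apply: null_eq_trans (null_eqD (rest_z av_xz) (_ : null_eq _ ('X_[edge T (hub T) z] + 'X_[edge T (hub T) y]))) _.
  apply: star_triangle; rewrite //= ?ey ?ne_1c ?ne_2c ?ne_1s //.
  by apply: star_avail => //=; rewrite ey eq_sym.
by rewrite Pk_addKA; apply: null_eq_refl.
Qed.

End Potential.

Lemma incident_edgem k (a b : 'I_k) s v : a != b ->
  incident v (edgem a b s) = (v == (b |: [set i in s], a)) || (v == (a |: [set i in s], b)).
Proof.
move=> ne_ab; rewrite /incident odd_edgem //; case: v => U i /=; rewrite !xpair_eqE.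
have supp c e : c != e -> [set j | (0 < (edgem c e s - U_(c))%MM j)%N] = e |: [set i in s].
  move=> ne_ce; apply/setP => j; rewrite !inE -wordm_gt0 mnmBE 2!mnmDE mulmnE !mnm1E.
  have [<-|_] := eqVneq c j; first by rewrite (negPf ne_ce) [e == c]eq_sym (negPf ne_ce); lia.
  by rewrite eq_sym; case: (j == e); lia.
have [->|_] /= := eqVneq i a; first by rewrite supp // (negPf ne_ab) !andbF orbF andbT eq_sym.
have [->|_] /= := eqVneq i b; last by rewrite !andbF.
by rewrite edgemC supp 1?eq_sym // andbT andbF eq_sym.
Qed.

(** * Paths to the hubs, a family dual to the vertex functionals *)

Section Branches.
Variables k n : nat.
Hypotheses (le4n : (4 <= n)%N) (le_kn : (k <= n)%N).
Local Notation letter := 'I_k.+1.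
Implicit Types (T S : {set letter}) (x y z : letter * bool) (v : {set letter} * letter).
Implicit Types (m : 'X_{1..k.+1}) (p : Pk k.+1).

Lemma incident_edge T x y v : x.1 \in T -> y.1 \in T -> x.1 != y.1 ->
  incident v (edge n T x y) = (v == vertex T x) || (v == vertex T y).
Proof.
move=> xT yT ne_xy; rewrite incident_edgem //.
have -> : [set i in padword n (core T x y)] = core T x y.
  by apply/setP => i; rewrite inE padword_mem.
by rewrite core_restore // coreC core_restore // eq_sym.
Qed.

Lemma edge_gt0 T x y i : x.1 \in T -> y.1 \in T ->
  (0 < edge n T x y i)%N = (i \in T).
Proof.
move=> xT yT; have -> : (0 < edge n T x y i)%N = [|| i == x.1, i == y.1 | i \in core T x y].
  rewrite -(padword_mem n) -wordm_gt0 2!mnmDE mulmnE !mnm1E ![_ == i]eq_sym.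
  by case: (i == x.1); case: (i == y.1); lia.
rewrite !(inE, in_erased); have [->|_] := eqVneq i x.1; first by rewrite xT.
by have [->|_] := eqVneq i y.1; rewrite ?yT ?andbF.
Qed.

Definition vsupport v : {set letter} := v.2 |: v.1.

Definition vletter v : letter * bool := (v.2, v.2 \in v.1).

(** Excludes the pairs with empty U, incident only to a single variable x_i, and one vertex in each
    component; what is left indexes a basis of the quotient. *)
Definition nonhub v := (v.1 != set0) && (v != vertex (vsupport v) (hub n (vsupport v))).

Definition branch v : Pk k.+1 := if nonhub v then hub_path n (vsupport v) (vletter v) else 0.

Lemma vertexK T x : x.1 \in T -> vsupport (vertex T x) = T /\ vletter (vertex T x) = x.
Proof.
move=> xT; split; last first.
  by case: x xT => i e iT; rewrite /vletter !(inE, in_erased) /= iT eqxx !andbT negbK.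
apply/setP => i; rewrite !(inE, in_erased) /=.
by have [->|_] := eqVneq i x.1; rewrite ?xT ?andbF.
Qed.

Lemma vletterK v : vertex (vsupport v) (vletter v) = v.
Proof.
case: v => U i; rewrite /vertex /=; congr (_, _); apply/setP => j.
by rewrite !(inE, in_erased) /=; have [->|_] := eqVneq j i; rewrite ?andbF ?andbT ?negbK.
Qed.

Lemma vletter_in v : (vletter v).1 \in vsupport v.
Proof. by rewrite !inE eqxx. Qed.

Lemma le_card_Sn T : (#|T| <= n.+1)%N.
Proof. by rewrite (leq_trans (max_card _)) // card_ord. Qed.

Lemma hub_nonempty T : (0 < #|T|)%N -> (vertex T (hub n T)).1 != set0.
Proof.
move=> T_gt0; have /card_gt0P[i iT] := T_gt0; have rT := letter1_in iT.
rewrite /= /erased /hub /= /star -card_gt0; case: (ltnP #|T| n) => [_|le_nT] /=;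
  first by rewrite setD0.
by move: le_nT; rewrite (cardsD1 (letter1 T) T) rT add1n; move: #|_ :\ _| => c; lia.
Qed.

(** Ensures that [letter2] is available when v is the twin of a hub: were T a single variable, the
    hub would carry the flag true and its twin would have empty U. *)
Lemma nonhub_letter v : nonhub v -> (vletter v).1 = letter1 (vsupport v) ->
  (vletter v).2 != star n (vsupport v) /\
  exists2 i, i \in vsupport v & i != letter1 (vsupport v).
Proof.
rewrite /nonhub; set T := vsupport v => /andP[v_n0 ne_root] eq1.
have ne2 : (vletter v).2 != star n T.
  apply: contraNneq ne_root => eq2.
  have -> : hub n T = vletter v by rewrite /hub -eq1 -eq2; case: (vletter v).
  by rewrite vletterK.
split=> //; have /set0Pn[i iv] := v_n0; have [ei|] := eqVneq i (letter1 T); last first.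
  by exists i => //; rewrite !inE iv orbT.
have v2 : v.2 \in v.1 by rewrite [v.2]eq1 -ei.
move: ne2; rewrite /vletter v2 /= /star eq_sym eqb_id -leqNgt => le_nT.
have /card_gt0P[j] : (0 < #|T :\ letter1 T|)%N.
  have rT : letter1 T \in T by apply: (letter1_in (vletter_in v)).
  by move: le_nT; rewrite (cardsD1 (letter1 T) T) rT; move: #|_ :\ _| => c; lia.
by rewrite !inE => /andP[ne_j jT]; exists j; rewrite ?inE.
Qed.

Lemma branch_ind v (P : Pk k.+1 -> Prop) :
  P 0 -> (forall p q, P p -> P q -> P (p + q)) ->
  (forall x y, x.1 \in vsupport v -> y.1 \in vsupport v -> x.1 != y.1 ->
     avail n (vsupport v) x y -> P 'X_[edge n (vsupport v) x y]) ->
  P (branch v).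
Proof.
move=> P0 PD PX; rewrite /branch; case: ifP => // nr_v.
have vT := vletter_in v; have rT := letter1_in vT.
have le_Tn := le_card_Sn (vsupport v).
rewrite /hub_path; case: eqVneq => [eq1|ne1]; last first.
  by apply: PX; rewrite //= 1?eq_sym //; apply: star_avail => //=; rewrite eq_sym.
have [/negPf -> [i iT ne_i]] := nonhub_letter nr_v eq1.
have [sT ne_s] := letter2_in iT ne_i.
have ne_s' : letter1 (vsupport v) != letter2 (vsupport v) by rewrite eq_sym.
have v2 : v.2 = letter1 (vsupport v) := eq1.
apply: PD; apply: PX; rewrite //= ?v2 //; apply: star_avail; rewrite //= ?v2 //.
Qed.

Lemma incidence_edge v T x y : x.1 \in T -> y.1 \in T -> x.1 != y.1 -> avail n T x y ->
  incidence (2 ^ n.+1) v 'X_[edge n T x y] = (v == vertex T x)%:R + (v == vertex T y)%:R.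
Proof.
move=> xT yT ne_xy av_xy; rewrite incidenceX mdeg_edgem size_padword // eqxx incident_edge //=.
have [->|_] := eqVneq v (vertex T x); last by rewrite add0r.
by rewrite /vertex xpair_eqE (negPf ne_xy) andbF addr0.
Qed.

(** Inner vertices of the path cancel modulo 2, leaving its ends v and the hub, and w is not a
    hub. *)
Lemma incidence_branch v w : nonhub v -> nonhub w ->
  incidence (2 ^ n.+1) w (branch v) = (w == v)%:R.
Proof.
move=> nr_v nr_w; rewrite /branch nr_v.
have vT := vletter_in v; have rT := letter1_in vT.
have ne_wr : (w == vertex (vsupport v) (hub n (vsupport v))) = false.
  apply/negP => /eqP eq_w; move: nr_w; rewrite /nonhub eq_w.
  by have [-> _] := vertexK (x := hub n (vsupport v)) rT; rewrite eqxx andbF.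
rewrite /hub_path; case: eqVneq => [eq1|ne1]; last first.
  rewrite incidence_edge //= 1?eq_sym //; last by apply: star_avail;
    rewrite //= ?le_card_Sn 1?eq_sym.
  by rewrite vletterK [_ == w]eq_sym ne_wr add0r.
have [/negPf -> [i iT ne_i]] := nonhub_letter nr_v eq1.
have [sT ne_s] := letter2_in iT ne_i;
  have ne_s' : letter1 (vsupport v) != letter2 (vsupport v) by rewrite eq_sym.
have v2 : v.2 = letter1 (vsupport v) := eq1.
rewrite linearD /= !incidence_edge //= ?v2 //;
  try by apply: star_avail; rewrite //= ?le_card_Sn ?v2.
rewrite vletterK ne_wr.
by case: (w == v); case: (w == _); apply/eqP.
Qed.

(** An edge meets exactly its two ends, and [edge_path] makes it the sum of their branches; at a hub
    both [branch] and [hub_path] are zero. *)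
Lemma null_expandX m : mdeg m = (2 ^ n.+1)%N ->
  evenm m \/ weq (weight m) (wvec (omega_d n.+1)) ->
  null ('X_[m] + \sum_v incidence (2 ^ n.+1) v 'X_[m] *: branch v).
Proof.
move=> deg_m [ev_m|/edgem_of_weight[a [b [s [ne_ab sz_s def_m]]]]].
  rewrite big1 ?addr0 => [|v _].
    by apply: null_even => m'; rewrite msuppX inE => /eqP ->.
  by rewrite incidenceX /incident (negPf (forallP ev_m v.2)) andbF scale0r.
set T := a |: (b |: [set i in s]); set x := (a, a \in s); set y := (b, b \in s).
have [coreE av_xy eq_xy] := edge_of_word le4n ne_ab sz_s.
have xT : x.1 \in T by rewrite !inE eqxx.
have yT : y.1 \in T by rewrite !inE eqxx orbT.
have ne_xy : x.1 != y.1 by [].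
have inc_m v : incidence (2 ^ n.+1) v 'X_[m] = (v == vertex T x)%:R + (v == vertex T y)%:R.
  rewrite -incidence_edge // !incidenceX mdeg_edgem size_padword // deg_m eqxx /=.
  rewrite incident_edge // def_m incident_edgem //.
  have -> : b |: [set i in s] = T :\: erased x by rewrite -(core_restore xT yT ne_xy) [core T x y]coreE.
  have -> : a |: [set i in s] = T :\: erased y.
    by rewrite -(core_restore yT xT) 1?eq_sym // coreC [core T x y]coreE.
  by [].
have sum_m : \sum_v incidence (2 ^ n.+1) v 'X_[m] *: branch v = branch (vertex T x) + branch (vertex T y).
  under eq_bigr => v _ do rewrite inc_m scalerDl.
  have pick1 w : \sum_v (v == w)%:R *: branch v = branch w.
    by rewrite (bigD1 w) //= eqxx scale1r big1 ?addr0 // => v /negPf ->; rewrite scale0r.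
  by rewrite big_split /= !pick1.
have branchE z : z.1 \in T -> vertex T z != (set0, z.1) -> branch (vertex T z) = hub_path n T z.
  move=> zT; rewrite xpair_eqE eqxx andbT => z_n0; rewrite /branch /nonhub.
  have [-> ->] := vertexK zT; rewrite z_n0 /=; case: eqVneq => //= eq_z.
  have [_] := vertexK zT; rewrite eq_z;
    have [_ ->] := vertexK (letter1_in zT : (hub n T).1 \in T).
  by move=> <-; rewrite /hub_path !eqxx.
have n0 z : z \in [:: x; y] -> vertex T z != (set0, z.1).
  move=> z_xy; rewrite xpair_eqE eqxx andbT -card_gt0.
  have /andP[core_gt0 _] := av_xy; apply: leq_trans core_gt0 _; apply: subset_leq_card.
  move: z_xy; rewrite !inE => /orP[] /eqP ->; first exact: subsetDl.
  by rewrite coreC; apply: subsetDl.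
rewrite sum_m !branchE ?n0 ?inE ?eqxx ?orbT //.
rewrite def_m; apply: null_eq_trans eq_xy _; exact: edge_path.
Qed.

Lemma null_expand p : Pw (omega_d n.+1) p ->
  null (p + \sum_v incidence (2 ^ n.+1) v p *: branch v).
Proof.
move=> /Pw_omegaP Pp.
have -> : p + \sum_v incidence (2 ^ n.+1) v p *: branch v =
   \sum_(m <- msupp p) p@_m *: ('X_[m] + \sum_v incidence (2 ^ n.+1) v 'X_[m] *: branch v).
  under [RHS]eq_bigr => m _ do rewrite scalerDr.
  rewrite big_split /= -mpolyE; congr (_ + _).
  under [RHS]eq_bigr => m _ do rewrite scaler_sumr.
  rewrite exchange_big; apply: eq_bigr => v _ /=.
  under [RHS]eq_bigr => m _ do rewrite scalerA.
  rewrite -scaler_suml; congr (_ *: _).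
  rewrite {1}(mpolyE p) linear_sum; apply: eq_bigr => m _.
  by rewrite linearZ.
rewrite big_seq; apply: null_sum => m /Pp[deg_m wm]; apply: nullZ.
exact: null_expandX.
Qed.

End Branches.

(** * Dimensions *)

(** The functionals vanish on W, so they are defined on the quotient and read off the coefficients
    there; this gives independence. *)
Lemma quot_dim_dual k (V W : Pk k -> Prop) (I : finType) (J : {set I})
    (A : I -> {linear Pk k -> ('F_2)^o}) (b : I -> Pk k) :
  (forall v, v \in J -> V (b v)) ->
  (forall v w, v \in J -> w \in J -> A w (b v) = (w == v)%:R) ->
  (forall p, V p -> W (p - \sum_(v in J | A v p != 0) b v)) ->
  (forall p v, W p -> A v p = 0) ->
  quot_dim V W #|J|.
Proof.
move=> Vb Ab span W0; exists [tuple b (enum_val i) | i < #|J|].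
split=> [i|]; first by rewrite tnth_mktuple; apply/Vb/enum_valP.
split=> [p /span Wp|s].
  exists [set i | A (enum_val i) p != 0]; move: Wp; rewrite big_enum_val_cond /=.
  congr (W (_ - _)); apply: eq_big => [i|i _]; first by rewrite inE.
  by rewrite tnth_mktuple.
move=> Ws; apply/setP => i; rewrite inE; have := W0 _ (enum_val i) Ws.
rewrite linear_sum /=; under eq_bigr => j _.
  by rewrite tnth_mktuple Ab ?enum_valP // (inj_eq enum_val_inj) over.
have [is_|//] := boolP (i \in s).
rewrite (bigD1 i) //= eqxx big1 ?addr0 => [|j /andP[_]]; last by rewrite eq_sym => /negPf ->.
by move/eqP; rewrite oner_eq0.
Qed.

Section Dimension.
Variables k n : nat.
Hypotheses (le4n : (4 <= n)%N) (le_kn : (k <= n)%N).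
Local Notation letter := 'I_k.+1.
Implicit Types (T S : {set letter}) (v : {set letter} * letter).
Implicit Types (m : 'X_{1..k.+1}) (p : Pk k.+1).

Lemma Pw0 w : Pw w (0 : Pk k.+1).
Proof. by move=> m; rewrite msupp0. Qed.

Lemma PwD w p q : Pw w p -> Pw w q -> Pw w (p + q).
Proof. by move=> Pp Pq m /msuppD_le; rewrite mem_cat => /orP[/Pp|/Pq]. Qed.

Lemma Pw_sum w (I : Type) (r : seq I) (P : pred I) (F : I -> Pk k.+1) :
  (forall i, P i -> Pw w (F i)) -> Pw w (\sum_(i <- r | P i) F i).
Proof. by move=> PF; apply: big_ind PF; [apply: Pw0 | apply: PwD]. Qed.

Lemma Pw_edge T x y : x.1 != y.1 -> avail n T x y -> Pw (omega_d n.+1) 'X_[edge n T x y].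
Proof.
move=> ne_xy av_xy; apply/Pw_omegaP => m; rewrite msuppX inE => /eqP ->.
rewrite mdeg_edgem size_padword //; split=> //; right.
by apply: edgem_weight; rewrite ?size_padword.
Qed.

Lemma Pw_branch v : Pw (omega_d n.+1) (branch n v).
Proof.
apply: branch_ind => //; [exact: Pw0 | exact: PwD|].
by move=> x y _ _ ne_xy; apply: Pw_edge.
Qed.

Lemma Pplus_branch v : vsupport v = setT -> Pplus (branch n v).
Proof.
move=> vT; apply: branch_ind => //; first by move=> m; rewrite msupp0.
  by move=> p q Pp Pq m /msuppD_le; rewrite mem_cat => /orP[/Pp|/Pq].
move=> x y xT yT _ _ m; rewrite msuppX inE => /eqP -> j.
by rewrite edge_gt0 // vT inE.
Qed.

Lemma incident_support v m : incident v m -> vsupport v = [set j | (0 < m j)%N].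
Proof.
case: v => U i /andP[/= odd_m /eqP <-]; apply/setP => j; rewrite !inE mnmBE mnm1E /=.
have [->|ne_ji] := eqVneq j i; first by case: (m i) odd_m.
by rewrite subn0.
Qed.

Lemma expand_Wsub p : Pw (omega_d n.+1) p ->
  Wsub (omega_d n.+1)
    (p - \sum_(v | nonhub n v && (incidence (2 ^ n.+1) v p != 0)) branch n v).
Proof.
move=> Pp; apply: Wsub_null; first by rewrite Pk_oppr; apply: PwD => //; apply: Pw_sum => v _;
  apply: Pw_branch.
rewrite Pk_oppr; have := null_expand le4n le_kn Pp; congr (null (_ + _)).
rewrite [RHS]big_mkcond; apply: eq_bigr => v _; rewrite {1}(F2_cases (incidence _ v p)).
by rewrite /branch; case: (nonhub n v) => /=; case: (_ != 0); rewrite ?scale1r ?scale0r ?scaler0.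
Qed.

Lemma dimQP_nonhub : dimQP k.+1 (omega_d n.+1) #|[set v | @nonhub k n v]|.
Proof.
apply: (quot_dim_dual (A := incidence (2 ^ n.+1)) (b := branch n)) => [v _|v w|p Pp|p v].
- exact: Pw_branch.
- by rewrite !inE => nv nw; apply: incidence_branch.
- have := expand_Wsub Pp; congr (Wsub _ (_ - _)).
  by apply: eq_bigl => v; rewrite inE.
- by move/null_Wsub; apply: incidence_null.
Qed.

Lemma dimQPplus_nonhub :
  dimQPplus k.+1 (omega_d n.+1) #|[set v | @nonhub k n v & vsupport v == setT]|.
Proof.
apply: (quot_dim_dual (A := incidence (2 ^ n.+1)) (b := branch n)) => [v|v w|p [Pplus_p Pp]|p v].
- by rewrite inE => /andP[_ /eqP vT]; split; [apply: Pplus_branch | apply: Pw_branch].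
- by rewrite !inE => /andP[nv _] /andP[nw _]; apply: incidence_branch.
- have := expand_Wsub Pp; congr (Wsub _ (_ - _)); apply: eq_bigl => v; rewrite inE.
  case: (nonhub n v) => //=; have [//|/eqP ne_vT] := eqVneq (vsupport v) setT.
  (* A vertex of smaller support is incident to no monomial with all exponents positive. *)
  rewrite (_ : incidence _ v p = 0) ?eqxx //; apply: big1 => m /andP[_ /incident_support supp_m].
  apply: memN_msupp_eq0; apply/negP => /Pplus_p m_gt0; case: ne_vT.
  by rewrite supp_m; apply/setP => j; rewrite !inE m_gt0.
- by move/null_Wsub; apply: incidence_null.
Qed.

Lemma card_nonhub : #|[set v | @nonhub k n v]| = ((2 ^ k.+1).-1 * k)%N.
Proof.
pose nonempty : {set {set letter}} := ~: [set set0].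
have card_ne : #|nonempty| = (2 ^ k.+1).-1.
  by rewrite cardsCs setCK cards1 -cardsT -powersetT card_powerset cardsT card_ord subn1.
pose hubs := [set vertex T (hub n T) | T in nonempty].
(* The support recovers T from its hub, so there is one hub for each nonempty T. *)
have hubT T : T \in nonempty -> vsupport (vertex T (hub n T)) = T.
  rewrite !inE -card_gt0 => /card_gt0P[i iT].
  by have [] := vertexK (x := hub n T) (letter1_in iT).
have card_hubs : #|hubs| = (2 ^ k.+1).-1.
  by rewrite card_in_imset // => T T' /hubT eT /hubT eT' eq_h; rewrite -eT eq_h eT'.
have -> : [set v | nonhub n v] = setX nonempty setT :\: hubs.
  apply/setP => -[U i]; rewrite !inE /nonhub andbC /= andbT.
  have [//|U_n0] := eqVneq U set0; rewrite ?andbF // !andbT; congr (~~ _).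
  apply/eqP/imsetP => [->|[T T_n0 eq_v]].
    by exists (vsupport (U, i)) => //; rewrite !inE; apply/set0Pn; exists i; rewrite !inE eqxx.
  by rewrite eq_v hubT.
have sub_hubs : hubs \subset setX nonempty setT.
  apply/subsetP => v /imsetP[T T_n0 ->]; rewrite !inE andbT; apply: hub_nonempty => //.
  by move: T_n0; rewrite !inE -card_gt0.
rewrite cardsD (setIidPr sub_hubs) card_hubs cardsX card_ne cardsT card_ord.
by rewrite mulnS addKn.
Qed.

(** Vertices of full support correspond to pairs of a variable and a flag, 2(k + 1) in number, and
    one of them is the hub. *)
Lemma card_nonhub_full : (0 < k)%N ->
  #|[set v | @nonhub k n v & vsupport v == setT]| = (k.*2.+1)%N.
Proof.
move=> k_gt0.
pose full : {set letter} := setT.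
have vK x : vsupport (vertex full x) = setT /\ vletter (vertex full x) = x by apply: vertexK;
  rewrite inE.
have -> : [set v | nonhub n v & vsupport v == setT] = vertex full @: [set~ hub n full].
  apply/setP => v; rewrite !inE; apply/andP/imsetP => [[/andP[_ ne_hub] /eqP vT]|[x ne_x ->]].
    have {}vT : vsupport v = full := vT.
    exists (vletter v); last by rewrite -vT vletterK.
    by rewrite !inE; apply: contraNneq ne_hub => eq_v; rewrite vT -eq_v -vT vletterK.
  have [vT vx] := vK x; rewrite vT eqxx; split=> //; rewrite /nonhub vT; apply/andP; split.
    rewrite -card_gt0 /= /erased; case: x.2; first by rewrite setD0 cardsT card_ord.
    have := cardsD1 x.1 full; rewrite inE cardsT card_ord.
    by move: #|full :\ x.1| => c; lia.
  move: ne_x; rewrite !inE; apply: contraNneq => eq_v.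
  by rewrite -vx eq_v; have [_ ->] := vK (hub n full).
rewrite card_imset => [|x y eq_xy]; last by have [_ <-] := vK x; rewrite eq_xy;
  have [_ ->] := vK y.
by rewrite cardsCs setCK cards1 card_prod card_ord card_bool; lia.
Qed.

End Dimension.

(** * Admissible monomials *)

Section Minimal.
Local Open Scope nat_scope.
Implicit Types (s t : seq nat) (e : bool) (m : 'X_{1..5}).

Definition has_bit (i v : nat) : bool := odd (v %/ 2 ^ i).

Lemma weight_count m i : weight m i = count (has_bit i) (multinom_val m).
Proof.
rewrite -sum1_count big_mkcond /weight big_tuple; apply: eq_bigr => j _.
by rewrite /has_bit -mnm_tnth; case: odd.
Qed.

(* Necessary conditions on the first exponents of a monomial of weight omega,
   all of whose exponents are positive, in which x_(i+1) has odd exponent,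
   exceeding 1 exactly when e holds. *)
Definition prefix_ok (i : nat) e s :=
  [&& all (ltn 0) s, count (has_bit 0) s + (size s <= i) <= 2,
      all (fun q => count (has_bit q) s <= 1) [:: 1; 2; 3] &
      (i < size s) ==> odd (nth 0 s i) && ((1 < nth 0 s i) == e)].

(** A certificate of lexicographic minimality decidable by computation: lowering any entry, with the
    earlier ones kept, breaks a necessary condition. *)
Definition prefix_minimal (i : nat) e s :=
  all (fun q => all (fun c => ~~ prefix_ok i e (rcons (take q s) c)) (iota 0 (nth 0 s q)))
      (iota 0 (size s)).

(** One of the two odd exponents is reserved for x_(i+1) while it is outside the prefix. Bits 0 to 3
    suffice, as the exponents tested in [tree_path_minimal] are at most 9. *)
Lemma prefix_ok_take d m (i : 'I_5) e q : 4 <= d ->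
  weq (weight m) (wvec (omega_d d.+1)) -> (forall j, 0 < m j) ->
  odd (m i) -> (1 < m i) = e -> prefix_ok i e (take q (multinom_val m)).
Proof.
move=> le4d wm m_gt0 odd_i eq_e; set s : seq nat := multinom_val m.
have sz_s : size s = 5 by rewrite size_tuple.
have nth_s : nth 0 s i = m i by rewrite -mnm_nth.
have le_count P : count P (take q s) <= count P s.
  by rewrite -[X in _ <= count _ X](cat_take_drop q s) count_cat leq_addr.
apply/and4P; split.
- apply/allP => c /mem_take /(nthP 0)[j]; rewrite sz_s => lt_j5 <-.
  by have := m_gt0 (Ordinal lt_j5); rewrite (mnm_nth 0).
- have count2 : count (has_bit 0) s = 2 by rewrite -weight_count wm.
  apply: leq_trans (_ : count (has_bit 0) s <= 2); last by rewrite count2.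
  rewrite -[X in _ <= count _ X](cat_take_drop q s) count_cat leq_add2l size_take_min sz_s.
  have [le_qi|//] := leqP (minn q 5) i; rewrite -has_count; apply/hasP; exists (m i).
    have le_qi' : q <= i by move: le_qi (ltn_ord i); rewrite geq_min; lia.
    rewrite -nth_s -(subnKC le_qi') -nth_drop mem_nth // size_drop sz_s.
    by have := ltn_ord i; lia.
  by rewrite /has_bit divn1.
- apply/allP => c c123; rewrite (leq_trans (le_count _)) // -weight_count wm.
  by move: c123; rewrite !inE => /or3P[] /eqP ->; rewrite wvec_omegaS; case: ltnP.
- by apply/implyP => lt_i;
  rewrite nth_take ?nth_s ?odd_i ?eq_e ?eqxx // (leq_trans lt_i) // size_take_min geq_minl.
Qed.

(** If the first difference fell inside s, the prefix of m ending there would be one that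
    [prefix_minimal] rules out. *)
Lemma minimal_prefix d m (a : 'X_{1..5}) (i : 'I_5) e s : 4 <= d ->
  weq (weight m) (wvec (omega_d d.+1)) -> (forall j, 0 < m j) ->
  odd (m i) -> (1 < m i) = e ->
  prefix_minimal i e s -> take (size s) (multinom_val a) = s ->
  siglt m a -> forall l : 'I_5, l < size s -> m l = a l.
Proof.
move=> le4d wm m_gt0 odd_i eq_e min_s def_s [j [eq_j lt_j]] l lt_ls.
have [lt_js|le_sj] := ltnP j (size s); last by apply: eq_j; apply: leq_trans le_sj.
have nth_s (c : 'I_5) : c < size s -> nth 0 s c = a c.
  by move=> lt_c; rewrite -def_s nth_take // -mnm_nth.
have sz (x : 'X_{1..5}) : size (multinom_val x : seq nat) = 5 by rewrite size_tuple.
have j_s : (j : nat) \in iota 0 (size s) by rewrite mem_iota.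
have mj_a : m j \in iota 0 (nth 0 s j) by rewrite mem_iota nth_s.
have /negP[] := allP (allP min_s _ j_s) _ mj_a.
suff -> : rcons (take j s) (m j) = take j.+1 (multinom_val m) by apply: prefix_ok_take le4d wm m_gt0 odd_i eq_e.
rewrite (take_nth 0) ?sz // -mnm_nth; congr rcons.
rewrite -def_s take_takel ?(ltnW lt_js) //.
apply: (@eq_from_nth _ 0); first by rewrite !size_take !sz.
move=> c; rewrite size_take sz ltn_ord => lt_cj; rewrite !nth_take //.
have lt_c5 := ltn_trans lt_cj (ltn_ord j).
by have := eq_j (Ordinal lt_c5) lt_cj; rewrite !(mnm_nth 0).
Qed.

Lemma siglt_asym k (u v : 'X_{1..k}) : siglt u v -> ~ siglt v u.
Proof.
move=> [i [eq_i lt_i]] [j [eq_j lt_j]]; have [lt_ij|lt_ji|eq_ij] := ltngtP i j.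
- by rewrite eq_j // ltnn in lt_i.
- by rewrite eq_i // ltnn in lt_j.
- by rewrite (val_inj eq_ij) in lt_i; have := ltn_trans lt_i lt_j; rewrite ltnn.
Qed.

Lemma siglt_total k (u v : 'X_{1..k}) : u <> v -> siglt u v \/ siglt v u.
Proof.
move=> ne_uv; have ex_j : exists j : 'I_k, u j != v j.
  have [/existsP//|/existsPn eq_uv] := boolP [exists j, u j != v j]; case: ne_uv.
  by apply/mnmP => j; apply/eqP/negPn/eq_uv.
have [j ne_j min_j] := arg_minnP (fun j : 'I_k => j : nat) (xchooseP ex_j).
have eq_l (l : 'I_k) : l < j -> u l = v l.
  by move=> lt_lj; apply/eqP/negPn/negP => /min_j; rewrite leqNgt lt_lj.
have [lt_j|lt_j|eq_j] := ltngtP (u j) (v j); last by rewrite eq_j eqxx in ne_j.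
  by left; exists j; split=> // l /eq_l.
by right; exists j; split=> // l /eq_l.
Qed.

End Minimal.

(** * The minimal spanning tree for full support in five variables *)

Section Admissible.
Variable n : nat.
Hypothesis le4n : (4 <= n)%N.
Implicit Types (m : 'X_{1..5}) (v : {set 'I_5} * 'I_5) (x : 'I_5 * bool).

Local Notation l0 := (Ordinal (isT : 0 < 5)%N).
Local Notation l1 := (Ordinal (isT : 1 < 5)%N).
Local Notation l2 := (Ordinal (isT : 2 < 5)%N).
Local Notation l3 := (Ordinal (isT : 3 < 5)%N).
Local Notation l4 := (Ordinal (isT : 4 < 5)%N).
Local Notation full := [set: 'I_5].

Lemma ord5_ind (P : 'I_5 -> Prop) : P l0 -> P l1 -> P l2 -> P l3 -> P l4 -> forall i, P i.
Proof.
move=> P0 P1 P2 P3 P4 [[|[|[|[|[|//]]]]] lt_i5].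
all: by rewrite (bool_irrelevance lt_i5 isT).
Qed.

Lemma wordm_nseq k r (a j : 'I_k) : wordm (nseq r a) j = ((a == j) * (2 ^ r).-1)%N.
Proof.
elim: r => [|r IHr] /=; first by rewrite mnm0E muln0.
rewrite mnmDE mulmnE mnm1E IHr expnS; case: (a == j); rewrite ?mul0n ?mul1n //.
by have := expn_gt0 2 r; lia.
Qed.

(** The a_{d,l} in the order of [a_list], with d = n + 1. A tail of n - 2 equal letters gives the
    exponent 2^d - 8, one of n - 3 letters gives 2^d - 16. *)
Definition tree_edges : seq ('I_5 * 'I_5 * seq 'I_5) :=
  [:: (l0, l1, [:: l2; l3] ++ nseq (n - 2) l4);
      (l0, l2, [:: l1; l3] ++ nseq (n - 2) l4);
      (l0, l3, [:: l1; l2] ++ nseq (n - 2) l4);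
      (l0, l4, [:: l1; l2] ++ nseq (n - 2) l3);
      (l0, l4, [:: l1; l2; l3] ++ nseq (n - 3) l4);
      (l0, l3, [:: l1; l2; l3] ++ nseq (n - 3) l4);
      (l0, l2, [:: l1; l2; l3] ++ nseq (n - 3) l4);
      (l0, l1, [:: l1; l2; l3] ++ nseq (n - 3) l4);
      (l0, l1, [:: l0; l2; l3] ++ nseq (n - 3) l4)].

Lemma a_list_edges : a_list n.+1 = [seq edgem t.1.1 t.1.2 t.2 | t <- tree_edges].
Proof.
have [N nE] : exists N, n = N.+4 by exists (n - 4)%N; move: le4n; lia.
rewrite /tree_edges nE /a_list /=.
rewrite -?[(N.+4 - 2)%N]/N.+2 -?[(N.+4 - 3)%N]/N.+1.
have N_gt0 : (0 < 2 ^ N)%N by rewrite expn_gt0.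
do 9?[congr (_ :: _)].
all: apply/mnmP; elim/ord5_ind; rewrite /edgem /=.
all: rewrite ?(mnmDE, mulmnE, mnm1E, wordm_nseq) mnm_tnth /= /tnth /=.
all: by rewrite ?expnS; move: (2 ^ N)%N N_gt0 => c; lia.
Qed.

Lemma incidence_full (a b : 'I_5) (s : seq 'I_5) v :
  a != b -> size s = n -> (forall i, i \in [:: a, b & s]) ->
  incidence (2 ^ n.+1) v 'X_[edgem a b s] =
    (v == vertex full (a, a \in s))%:R + (v == vertex full (b, b \in s))%:R.
Proof.
move=> ne_ab sz_s full_s; rewrite incidenceX mdeg_edgem sz_s eqxx incident_edgem //=.
have -> : b |: [set i in s] = full :\: erased (a, a \in s).
  apply/setP => i; rewrite !(inE, in_erased) /= andbT; have := full_s i; rewrite !inE.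
  by have [->|_] := eqVneq i a; rewrite ?andbF //= (negPf ne_ab) andbT negbK.
have -> : a |: [set i in s] = full :\: erased (b, b \in s).
  apply/setP => i; rewrite !(inE, in_erased) /= andbT; have := full_s i; rewrite !inE.
  by have [->|_] := eqVneq i b; rewrite ?andbF ?orbF //= eq_sym (negPf ne_ab) andbT negbK.
rewrite -/(vertex full (a, a \in s)) -/(vertex full (b, b \in s)).
have [->|_] := eqVneq v (vertex full (a, _)); last by rewrite add0r.
by rewrite /vertex xpair_eqE (negPf ne_ab) andbF addr0.
Qed.

Local Notation a_ i := (nth 0%MM (a_list n.+1) i).

(** The nine pairs on the right are the ends of the edges: a tree on the ten vertices of full
    support. *)
Lemma incidence_a_list v :
  [seq incidence (2 ^ n.+1) v 'X_[a] | a <- a_list n.+1] =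
  [seq (v == vertex full t.1)%:R + (v == vertex full t.2)%:R | t <-
    [:: ((l0, false), (l1, false)); ((l0, false), (l2, false)); ((l0, false), (l3, false));
        ((l0, false), (l4, false)); ((l0, false), (l4, true)); ((l0, false), (l3, true));
        ((l0, false), (l2, true)); ((l0, false), (l1, true)); ((l0, true), (l1, false))]].
Proof.
have [n2 n3] : (n - 2 = (n - 3).+1 /\ n - 3 = (n - 4).+1)%N by move: le4n; lia.
rewrite a_list_edges /tree_edges /=.
do 9?[congr (_ :: _)].
all: rewrite incidence_full ?n2 ?n3 //=;
  [ congr ((v == vertex full (_, _))%:R + (v == vertex full (_, _))%:R)
  | by rewrite size_nseq; move: le4n; lia
  | by elim/ord5_ind; rewrite !inE mem_nseq !eqE /= ].
all: by rewrite !inE mem_nseq !eqE /= ?andbF.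
Qed.

(* The edges on the path from [x] to the root [(l0, false)] of the tree. *)
Definition tree_path x : seq 'X_{1..5} :=
  match val x.1, x.2 with
  | 0, false => [::]
  | 0, true => [:: a_ 8; a_ 0]
  | 1, false => [:: a_ 0] | 2, false => [:: a_ 1] | 3, false => [:: a_ 2]
  | 1, true => [:: a_ 7] | 2, true => [:: a_ 6] | 3, true => [:: a_ 5]
  | _, false => [:: a_ 3] | _, true => [:: a_ 4]
  end%N.

Lemma F2_addrr (c : 'F_2) : c + c = 0.
Proof. by case: c => [[|[|//]]] ?; apply/val_inj. Qed.

Lemma incidence_tree_path v x :
  \sum_(a <- tree_path x) incidence (2 ^ n.+1) v 'X_[a] =
  (v == vertex full x)%:R + (v == vertex full (l0, false))%:R.
Proof.
have := incidence_a_list v; case=> e0 e1 e2 e3 e4 e5 e6 e7 e8.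
case: x => i e; elim/ord5_ind: i; case: e;
  rewrite /tree_path /= ?big_cons ?big_nil ?addr0 ?e0 ?e1 ?e2 ?e3 ?e4 ?e5 ?e6 ?e7 ?e8.
all: try by rewrite addrC.
  by rewrite addrACA F2_addrr addr0.
by rewrite F2_addrr.
Qed.

Lemma mdeg_omega m : weq (weight m) (wvec (omega_d n.+1)) -> mdeg m = (2 ^ n.+1)%N.
Proof. by move=> /edgem_of_weight[a [b [s [_ sz_s ->]]]]; rewrite mdeg_edgem sz_s. Qed.

Lemma weight_a_list a : a \in a_list n.+1 -> weq (weight a) (wvec (omega_d n.+1)).
Proof.
have /allP size_ok : all (fun t => (t.1.1 != t.1.2) && (size t.2 == n)) tree_edges.
  have [n2 n3] : ((n - 2).+2 = n /\ (n - 3).+3 = n)%N by move: le4n; lia.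
  by rewrite /tree_edges /= !size_nseq n2 n3 !eqxx.
by rewrite a_list_edges => /mapP[t /size_ok/andP[ne_t /eqP sz_t] ->]; apply: edgem_weight.
Qed.

Lemma eq_mnm_but_one k (u v : 'X_{1..k}) (i : 'I_k) :
  mdeg u = mdeg v -> (forall j, j != i -> u j = v j) -> u = v.
Proof.
rewrite !mdegE (bigD1 i) // [in RHS](bigD1 i) //= => eq_deg eq_j.
have eq_i : u i = v i by move: eq_deg; rewrite (eq_bigr _ eq_j) => /addIn.
by apply/mnmP => j; have [->|/eq_j] := eqVneq j i.
Qed.

Lemma tree_path_a_list x a : a \in tree_path x -> a \in a_list n.+1.
Proof.
case: x => i e; elim/ord5_ind: i; case: e; rewrite /tree_path /= !in_cons.
all: rewrite ?in_nil ?orbF //.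
all: by do ?[case/orP]; move=> /eqP ->; rewrite eqxx ?orbT.
Qed.

(** Each monomial on the path is at most every full-support monomial incident to x. Computation
    compares the first four exponents, and the degree fixes the fifth. *)
Lemma tree_path_minimal x m a : weq (weight m) (wvec (omega_d n.+1)) ->
  (forall j, (0 < m j)%N) -> odd (m x.1) -> (1 < m x.1)%N = x.2 ->
  a \in tree_path x -> a = m \/ siglt a m.
Proof.
move=> wm m_gt0 odd_m eq_e a_x; have wa := weight_a_list (tree_path_a_list a_x).
have eq_deg : mdeg m = mdeg a by rewrite !mdeg_omega.
have [->|/eqP ne_am] := eqVneq a m; [by left | right].
have [//|lt_ma] := siglt_total ne_am; case: ne_am; apply/esym.
have min s : prefix_minimal x.1 x.2 s -> take (size s) (multinom_val a) = s ->
    forall l : 'I_5, (l < size s)%N -> m l = a l.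
  by move=> min_s def_s; apply: (minimal_prefix le4n wm m_gt0 odd_m eq_e).
have four b1 b2 b3 b4 b5 : a = mon5 b1 b2 b3 b4 b5 ->
    prefix_minimal x.1 x.2 [:: b1; b2; b3; b4] -> m = a.
  move=> def_a min_b; apply: (@eq_mnm_but_one _ _ _ l4 eq_deg) => l ne_l4.
  apply: (min _ min_b); first by rewrite def_a.
  by move: ne_l4; elim/ord5_ind: l.
case: x odd_m eq_e a_x {min} four min => i e; elim/ord5_ind: i;
  case: e => /= odd_m eq_e a_x four min.
all: move: a_x; rewrite /tree_path /= ?in_nil ?inE //.
- by case/orP => /eqP def_a; apply: (four _ _ _ _ _ def_a); vm_compute.
all: move=> /eqP def_a; try by apply: (four _ _ _ _ _ def_a); vm_compute.
(* The case of a_{d,4}, whose fourth exponent depends on d: three exponents are compared, the last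
   is 1 by its flag and parity, and the degree fixes the fourth. *)
have m_l := min [:: 1; 2; 4]%N (isT : prefix_minimal 4 false [:: 1; 2; 4]%N) _.
rewrite def_a in eq_deg m_l *; apply: (@eq_mnm_but_one _ _ _ l3 eq_deg) => l ne_l3.
have [-> |ne_l4] := eqVneq l l4.
  by move: eq_e odd_m; case: (m l4) => [|[|?]].
by apply: m_l => //; move: ne_l3 ne_l4; elim/ord5_ind: l.
Qed.

Lemma core_full (a b : 'I_5) (s : seq 'I_5) : (forall j, (0 < edgem a b s j)%N) ->
  forall i, i \in [:: a, b & s].
Proof.
move=> pos i; have := pos i; rewrite !inE 2!mnmDE mulmnE !mnm1E ![_ == i]eq_sym -wordm_gt0.
by case: (i == a) => //; case: (i == b) => //; case: (wordm s i).
Qed.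

Lemma exponent_gt1 (a b : 'I_5) (s : seq 'I_5) : a != b ->
  (1 < edgem a b s a)%N = (a \in s).
Proof.
move=> ne_ab; rewrite 2!mnmDE mulmnE !mnm1E eqxx [b == a]eq_sym (negPf ne_ab) -wordm_gt0.
by case: (wordm s a) => // c; lia.
Qed.

Lemma siglt_monlt m a : weq (weight m) (wvec (omega_d n.+1)) ->
  weq (weight a) (wvec (omega_d n.+1)) -> siglt a m -> monlt a m.
Proof.
move=> wm wa lt_am; split; first by rewrite !mdeg_omega.
by right; split=> // i; rewrite wm wa.
Qed.

(** Adding to m the tree paths from its two ends gives a cycle, on which all vertex functionals
    vanish; so it is null. By minimality the path monomials are smaller than m. *)
Lemma admissible_mem m : weq (weight m) (wvec (omega_d n.+1)) ->
  (forall j, (0 < m j)%N) -> admissible m -> m \in a_list n.+1.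
Proof.
move=> wm m_gt0 adm; apply/negPn/negP => m_notin; apply: adm.
have [a [b [s [ne_ab sz_s def_m]]]] := edgem_of_weight wm.
set x := (a, a \in s); set y := (b, b \in s).
have odd_m i : i \in [:: a; b] -> odd (m i) by rewrite def_m odd_edgem // !inE.
have x_gt1 : (1 < m a)%N = x.2 by rewrite def_m exponent_gt1.
have y_gt1 : (1 < m b)%N = y.2 by rewrite def_m edgemC exponent_gt1 // eq_sym.
have lt_path c : c \in tree_path x ++ tree_path y -> siglt c m.
  rewrite mem_cat => c_xy.
  have [c_a|//] : c = m \/ siglt c m.
    case/orP: c_xy; [apply: (@tree_path_minimal x) => // | apply: (@tree_path_minimal y) => //].
      by apply: odd_m; rewrite !inE eqxx.
    by apply: odd_m; rewrite !inE eqxx orbT.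
  by case/negP: m_notin; rewrite -c_a; case/orP: c_xy => /tree_path_a_list.
have c_list c : c \in tree_path x ++ tree_path y -> c \in a_list n.+1.
  by rewrite mem_cat => /orP[] /tree_path_a_list.
pose p : Pk 5 := 'X_[m] + \sum_(c <- tree_path x ++ tree_path y) 'X_[c].
have Pp : Pw (omega_d n.+1) p.
  have PX c : weq (weight c) (wvec (omega_d n.+1)) -> Pw (omega_d n.+1) ('X_[c] : Pk 5).
    by move=> wc; apply/Pw_omegaP => c'; rewrite msuppX inE => /eqP ->; rewrite mdeg_omega //;
      split=> //; right.
  apply: PwD; first exact: PX.
  by rewrite big_seq; apply: Pw_sum => c /c_list/weight_a_list; apply: PX.
have inc_p v : incidence (2 ^ n.+1) v p = 0.
  rewrite /p linearD /= linear_sum /= big_cat /= !incidence_tree_path def_m.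
  rewrite incidence_full //; last by apply: core_full; rewrite -def_m.
  rewrite -/x -/y [_ + (_ == vertex full (l0, _))%:R]addrC [X in _ + (_ + X)]addrC.
  by rewrite [X in _ + X]addrACA F2_addrr add0r F2_addrr.
have null_p : null p.
  have := @null_expand 4 n le4n le4n p Pp.
  by rewrite big1 ?addr0 // => v _; rewrite inc_p scale0r.
(* The monomials of q have smaller weight than m, so they may join the path monomials. *)
have [h [q [hh [_ [Pq def_p]]]]] := Wsub_null Pp null_p.
exists (tree_path x ++ tree_path y ++ msupp q); split.
  move=> c; rewrite catA mem_cat => /orP[c_xy|/Pq[deg_c lt_c]].
    by apply: siglt_monlt (lt_path _ c_xy) => //; apply/weight_a_list/c_list.
  split; first by rewrite deg_c wdeg_omega mdeg_omega.
  left; have [i [eq_i lt_i]] := lt_c; exists i; rewrite wm; split=> // j lt_ji.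
  by rewrite eq_i // wm.
rewrite catA big_cat /= addrA -/p def_p.
have <- : q = \sum_(c <- msupp q) 'X_[c].
  rewrite [LHS]mpolyE big_seq [RHS]big_seq; apply: eq_bigr => c c_q.
  by rewrite (F2_cases q@_c) -mcoeff_msupp c_q scale1r.
by rewrite -addrA Pk_addrr addr0.
Qed.

(** The functional at a suitable end x of a takes the value 1 on a. It vanishes on every smaller
    monomial: one of smaller weight is even, and one of equal weight incident to x is at least a.
    Hit polynomials have value 0. *)
Lemma mem_admissible a : a \in a_list n.+1 ->
  (forall j, (0 < a j)%N) /\ admissible a.
Proof.
move=> a_in; have wa := weight_a_list a_in.
(* The suitable end is the one farther from the root, so that a lies on its path. *)
have [x a_x inc_a] : exists2 x, a \in tree_path x & incident (vertex full x) a.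
  have at_x x y : a \in tree_path x -> x.1 != y.1 ->
      incidence (2 ^ n.+1) (vertex full x) 'X_[a] =
        (vertex full x == vertex full y)%:R + (vertex full x == vertex full x)%:R ->
      exists2 x, a \in tree_path x & incident (vertex full x) a.
    move=> a_x ne_xy; rewrite incidenceX mdeg_omega // !eqxx xpair_eqE (negPf ne_xy) andbF add0r.
    by case inc_xa: (incident _ a) => // _; exists x.
  case/(nthP 0%MM): (a_in) => i lt_i9 def_a.
  have inc_a v : incidence (2 ^ n.+1) v 'X_[a] =
      nth 0 [seq incidence (2 ^ n.+1) v 'X_[a] | a <- a_list n.+1] i.
    by rewrite (nth_map 0%MM) // def_a.
  have {}inc_a v := etrans (inc_a v) (congr1 (nth 0 ^~ i) (incidence_a_list v)).
  move: at_x inc_a lt_i9; rewrite -{}def_a {a_in wa}.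
  do 9?[case: i => [|i]] => // at_x inc_a _.
  - by apply: (at_x (l1, false) (l0, false)); rewrite ?mem_seq1 ?inc_a.
  - by apply: (at_x (l2, false) (l0, false)); rewrite ?mem_seq1 ?inc_a.
  - by apply: (at_x (l3, false) (l0, false)); rewrite ?mem_seq1 ?inc_a.
  - by apply: (at_x (l4, false) (l0, false)); rewrite ?mem_seq1 ?inc_a.
  - by apply: (at_x (l4, true) (l0, false)); rewrite ?mem_seq1 ?inc_a.
  - by apply: (at_x (l3, true) (l0, false)); rewrite ?mem_seq1 ?inc_a.
  - by apply: (at_x (l2, true) (l0, false)); rewrite ?mem_seq1 ?inc_a.
  - by apply: (at_x (l1, true) (l0, false)); rewrite ?mem_seq1 ?inc_a.
  - by apply: (at_x (l0, true) (l1, false)); rewrite ?mem_head // inc_a addrC.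
have supp_full m : incident (vertex full x) m -> forall j, (0 < m j)%N.
  move=> /incident_support; have [-> _] := @vertexK 4 full x (in_setT _).
  by move=> /setP supp_m j; have := supp_m j; rewrite !inE.
split; first exact: supp_full.
move=> [vs [lt_vs hit_vs]].
have := incidence_hit n.+1 (vertex full x) hit_vs.
rewrite linearD /= incidenceX mdeg_omega // eqxx inc_a /= linear_sum big1_seq /= => [|m /lt_vs[deg_m lt_m]].
  by rewrite addr0 => /eqP; rewrite oner_eq0.
rewrite incidenceX; case: (boolP (incident (vertex full x) m)) => inc_m; rewrite ?andbF // andbT.
have /andP[odd_m _] := inc_m; have deg_m' : mdeg m = (2 ^ n.+1)%N by rewrite deg_m mdeg_omega.
case: lt_m => [lt_w|[eq_w lt_s]].
  have /forallP/(_ x.1) : evenm m.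
    apply: (wlt_evenm deg_m'); have [i [eq_i lt_i]] := lt_w; exists i.
    by rewrite -wa; split=> // j /eq_i ->; rewrite wa.
  by rewrite odd_m.
have wm : weq (weight m) (wvec (omega_d n.+1)) by move=> i; rewrite eq_w wa.
have gt1_m : (1 < m x.1)%N = x.2.
  have /andP[_ /eqP/setP/(_ x.1)] := inc_m.
  by rewrite !(inE, in_erased) eqxx mnmBE mnm1E eqxx subn_gt0 /= !andbT negbK.
case: (tree_path_minimal wm (supp_full _ inc_m) odd_m gt1_m a_x) => [def_a|/siglt_asym //].
by case: lt_s => j []; rewrite def_a ltnn.
Qed.

Lemma admissible_a_list m :
  ((forall i, weight m i = wvec (omega_d n.+1) i) /\ (forall j, (0 < m j)%N) /\ admissible m)
  <-> m \in a_list n.+1.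
Proof.
split=> [[wm [m_gt0 adm]]|m_in]; first exact: admissible_mem.
by split; [apply: weight_a_list | apply: mem_admissible].
Qed.


End Admissible.

Theorem theorem3p3 (d : nat) : (5 <= d)%N ->
  (forall x : 'X_{1..5},
     ((forall i, weight x i = wvec (omega_d d) i) /\
      (forall j : 'I_5, (0 < x j)%N) /\ admissible x)
     <-> x \in a_list d) /\
  dimQPplus 5 (omega_d d) 9 /\
  dimQP 5 (omega_d d) 124.
Proof.
case: d => // n; rewrite ltnS => le4n; split; first exact: admissible_a_list.
(* Five variables mean k = 4, and the words have length n = d - 1; the counts are 2 · 4 + 1 = 9 and
   31 · 4 = 124. *)
split; first by have := dimQPplus_nonhub le4n le4n; rewrite card_nonhub_full.
by have := dimQP_nonhub le4n le4n; rewrite card_nonhub.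
Qed.
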